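(* Suppose that $\mu$ is a doubling measure on $\mathbb{R}^n$ and $\mathcal{D}$ is a dyadic grid on $\mathbb{R}^n$. For $s>0$ sufficiently small (depending on $\mu$), we have $$\|f\|^2_{W^s_{\mathcal{D}_{\mathrm{diff}};1}(\mu)}\approx\|f\|^2_{W^s(\mu)},$$ with implied constants independent of $f\in L^2(\mu)$.
   Context: $\ell(Q)$ is the side length of a cube $Q$ and $|E|_\mu=\mu(E)$. A positive locally finite Borel measure $\mu$ on $\mathbb{R}^n$ is doubling if there is $C_{\mathrm{doub}}$ with $|2Q|_\mu\le C_{\mathrm{doub}}|Q|_\mu$ for all cubes $Q$ with sides parallel to the axes ($2Q$ is the concentric double). The norms are $$\|f\|^2_{W^s_{\mathcal{D}_{\mathrm{diff}};1}(\mu)}=\sum_{Q\in\mathcal{D}}\int_Q\left|\frac{f(x)-E_Q^\mu f}{\ell(Q)^s}\right|^2d\mu(x),\qquad E_Q^\mu f=\frac1{|Q|_\mu}\int_Q f\,d\mu,$$ $$\|f\|^2_{W^s(\mu)}=\int_{\mathbb{R}^n}\int_{\mathbb{R}^n}\left(\frac{f(x)-f(y)}{|x-y|^s}\right)^2\frac{d\mu(x)\,d\mu(y)}{\left|B\left(\frac{x+y}{2},\frac{|x-y|}{2}\right)\right|_\mu}.$$ Here $A\approx B$ means $c^{-1}A\le B\le cA$ for a positive constant $c$. *)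

(* Defs.v *)
From HB Require Import structures.
From mathcomp Require Import all_boot all_order all_algebra.
From mathcomp Require Import all_classical all_reals all_analysis.

Set Implicit Arguments.
Unset Strict Implicit.
Unset Printing Implicit Defensive.

Import Order.TTheory GRing.Theory Num.Theory.
Import numFieldNormedType.Exports.

Local Open Scope classical_set_scope.
Local Open Scope ring_scope.

(* R^n with its Borel sigma-algebra. *)
Notation borelRn R n := (g_sigma_algebraType (@open 'rV[R]_n)).

Section Euclidean.
Context (R : realType) (n : nat).

(* The library norm on 'rV[R]_n is the sup norm; |x| here is Euclidean. *)
Definition enorm (x : 'rV[R]_n) : R := Num.sqrt (\sum_(i < n) x ord0 i ^+ 2).

Definition eball (x : 'rV[R]_n) (r : R) : set 'rV[R]_n :=
  [set y | enorm (y - x) < r].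

(* A cube with sides parallel to the axes is coded by its lower corner and its
   side length; [cube_set Q] is the half-open cube when [0 < side Q]. *)
Definition cube : Type := ('rV[R]_n * R)%type.

Definition corner (Q : cube) : 'rV[R]_n := Q.1.

Definition side (Q : cube) : R := Q.2.

Definition cube_set (Q : cube) : set 'rV[R]_n :=
  [set x | forall i, corner Q ord0 i <= x ord0 i < corner Q ord0 i + side Q].

(* The concentric cube of twice the side length. *)
Definition double (Q : cube) : cube :=
  (corner Q - const_mx (side Q / 2), 2 * side Q).

Definition dyadic_grid (D : set cube) : Prop :=
  [/\ forall Q, D Q -> exists k : int, side Q = 2 ^ k,
      forall k : int,
        partition [set Q | D Q /\ side Q = 2 ^ k] cube_set [set: 'rV[R]_n]
    & forall Q Q', D Q -> D Q' ->
        [\/ cube_set Q `<=` cube_set Q', cube_set Q' `<=` cube_set Q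
          | cube_set Q `&` cube_set Q' = set0]].

End Euclidean.

Section Sobolev.
Context (R : realType) (n : nat) (mu : {measure set (borelRn R n) -> \bar R}).

Definition locally_finite_measure : Prop :=
  forall x : 'rV[R]_n, exists2 U, open_nbhs x U & (mu U < +oo)%E.

Definition doubling : Prop :=
  exists C : R, forall Q : cube R n, 0 < side Q ->
    (mu (cube_set (double Q)) <= C%:E * mu (cube_set Q))%E.

Definition average (Q : cube R n) (f : 'rV[R]_n -> R) : R :=
  (\int[mu]_(x in cube_set Q) f x) / fine (mu (cube_set Q)).

Definition dyadic_sobolev_sqnorm (D : set (cube R n)) (s : R)
    (f : 'rV[R]_n -> R) : \bar R :=
  (\esum_(Q in D)
    \int[mu]_(x in cube_set Q)
      ((`|(f x - average Q f) / side Q `^ s| ^+ 2)%R)%:E)%E.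

(* On the diagonal the integrand is 0 * (mu set0)^-1 = 0 * +oo = 0. *)
Definition sobolev_integrand (s : R) (f : 'rV[R]_n -> R)
    (x y : 'rV[R]_n) : \bar R :=
  ((((f x - f y) / enorm (x - y) `^ s) ^+ 2)%:E
    / mu (eball (2^-1 *: (x + y)) (enorm (x - y) / 2)%R))%E.

Definition sobolev_sqnorm (s : R) (f : 'rV[R]_n -> R) : \bar R :=
  (\int[mu]_y \int[mu]_x sobolev_integrand s f x y)%E.

End Sobolev.

(* Main.v *)
Require Import Defs.
From HB Require Import structures.
From mathcomp Require Import all_boot all_order all_algebra.
From mathcomp Require Import all_classical all_reals all_analysis.
From mathcomp Require Import measurable_realfun.
From mathcomp Require Import ring lra.

(** Both norms integrate [(f x - f y) ^ 2] against a kernel. With [l] the side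
length, the dyadic norm corresponds, up to the factor 2, to the kernel that
sums [l(Q) ^ (- 2 s) / mu Q] over the cubes [Q] of the grid containing both
[x] and [y]; the Sobolev norm to [|x - y| ^ (- 2 s) / mu B], where [B] is the
ball with diameter [x y].

The dyadic norm is the smaller one, for every [s > 0]. A cube containing [x]
and [y] has side at least a constant times [|x - y|] and measure at least a
constant times [mu B] by doubling, and there is at most one such cube in each
generation, so the dyadic kernel is bounded by a geometric series
([kernel_sum_le]) whose sum is comparable to the Sobolev kernel
([pair_sum_le]). Jensen's inequality ([jensen_sqr]) turns the oscillation of
[f] around its average into the double integral of [(f x - f y) ^ 2].

For the converse, two close points may lie in different, even in disjoint,
towers of nested cubes. Take the generation whose side is comparable to
[|x - y|] and the cubes [P] of [x] and [P'] of [y]. Apart from the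
oscillations of [f] on [P] and on [P'], the difference [f x - f y] involves
the difference of the two averages, which is telescoped along the ancestors of
[P] and [P']. The ancestors of order [j] contribute only when they differ, and
then [x] and [y] are within [l(P)] of their boundaries ([ancestor_halo]). No
common ancestor has to exist: as [f] is square integrable and the measure of
the ancestors tends to infinity ([mu_ancestor_growth]), the averages tend to
zero on both sides. The Cauchy-Schwarz inequality with weights [t ^ j]
([avg_diff_le]) then bounds the square of this difference by a sum of squared
jumps of the averages, each restricted to a boundary layer.

After integration ([sobolev_le_osc]) and regrouping by ancestor
([halo_sum_le]), each cube [Q] carries the squared jump from [Q] to its parent
times a series in [j] with ratio [t * 4 ^ s * r], where [r] is the decay rate
of the measure of the boundary layer of relative width [2 ^ (- j)] in [Q]
([halo_decay]). As [r < 1] depends on [mu] alone, [t > 1] can be chosen so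
that the ratio stays below 1 for all small [s]; this is where [s] has to be
small. The jumps are controlled by the oscillation of [f] on the parents
([jump_sum_le]), hence by the dyadic norm. *)

Set Implicit Arguments.
Unset Strict Implicit.
Unset Printing Implicit Defensive.

Import Order.TTheory GRing.Theory Num.Theory.
Import numFieldNormedType.Exports.

Local Open Scope classical_set_scope.
Local Open Scope ring_scope.

(** * Sums over sets and integrals of nonnegative functions *)

Section Sums.
Context {R : realType}.
Local Open Scope ereal_scope.

Lemma esum_single (I : choiceType) (D : set I) (u : I -> \bar R) (i : I) :
  D i -> 0 <= u i -> (forall j, D j -> j <> i -> u j = 0) ->
  \esum_(j in D) u j = u i.
Proof.
move=> Di ui u0; rewrite -(esum_set1 ui) [LHS]esum_mkcond [RHS]esum_mkcond.
apply: eq_esum => j _; case: ifPn => Dj; case: ifPn => //=.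
- by rewrite notin_setE => ji; apply: u0 => //; exact: set_mem.
- by move=> /set_mem ji; move: Dj; rewrite ji notin_setE.
Qed.

Lemma le_esum_subset (I : choiceType) (A B : set I) (u : I -> \bar R) :
  A `<=` B -> \esum_(i in A) u i <= \esum_(i in B) u i.
Proof.
move=> AB; apply: ge_ereal_sup => _ [X [finX XA] <-].
by apply: ereal_sup_ubound; exists X => //; split => //; exact: subset_trans AB.
Qed.

Lemma exchange_esum (I J : choiceType) (A : set I) (B : set J)
    (u : I -> J -> \bar R) : (forall i j, A i -> B j -> 0 <= u i j) ->
  \esum_(i in A) \esum_(j in B) u i j = \esum_(j in B) \esum_(i in A) u i j.
Proof.
move=> u0; rewrite esum_esum// esum_esum; last by move=> *; exact: u0.
rewrite (reindex_esum (B `*`` (fun=> A)) _ (fun x : J * I => (x.2, x.1)))//.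
split=> [[j i]|[j i] [j' i'] _ _ []|[i j]]//=; first by case.
- by move=> -> ->.
- by case=> ? ?; exists (j, i).
Qed.

(** Regrouping of a sum along the fibers of a map [h]; it is used with [h] the
passage from a cube to one of its ancestors. *)
Lemma esum_fiber (I J : choiceType) (A : set I) (B : set J) (h : I -> J)
    (u : I -> \bar R) : (forall i, A i -> B (h i)) ->
  (forall i, A i -> 0 <= u i) ->
  \esum_(i in A) u i = \esum_(j in B) \esum_(i in A `&` h @^-1` [set j]) u i.
Proof.
move=> AB u0; under [RHS]eq_esum do rewrite esum_mkcondr.
rewrite exchange_esum; last by move=> i j Ai Bj; case: ifP => // _; exact: u0.
apply: eq_esum => i Ai; rewrite (esum_single (AB i Ai)).
- by rewrite ifT//; exact/mem_set.
- by case: ifP => // _; exact: u0.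
- by move=> j Bj jh; rewrite ifF//; apply/negP => /set_mem/esym.
Qed.

Lemma esumZl (I : choiceType) (D : set I) (u : I -> \bar R) (c : R) :
  (0 <= c)%R -> (forall i, D i -> 0 <= u i) ->
  \esum_(i in D) (c%:E * u i) = c%:E * \esum_(i in D) u i.
Proof.
move=> c0 u0; rewrite esum_mkcond [in RHS]esum_mkcond.
pose v i := if i \in D then u i else 0.
have v0 i : 0 <= v i by rewrite /v; case: ifPn => // /set_mem /u0.
transitivity (\esum_(i in [set: I]) (c%:E * v i)).
  by apply: eq_esum => i _; rewrite /v; case: ifPn; rewrite ?mule0.
rewrite /esum -ereal_supZl//; last first.
  by apply/set0P; exists 0, set0; [exact: fsets_set0|rewrite fsbig_set0].
congr ereal_sup; apply/seteqP; split => [_ [X XT <-]|_ [_ [X XT <-] <-]].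
  by exists (\sum_(i \in X) v i); [exists X|rewrite ge0_mule_fsumr].
by exists X => //; rewrite ge0_mule_fsumr.
Qed.

Lemma countable_enum (I : choiceType) (D : set I) : countable D -> D !=set0 ->
  exists (B : set nat) (e : nat -> I), set_bij B D e.
Proof.
move=> /countable_injP[f finj] [i0 Di0].
pose e n := xget i0 [set i | D i /\ f i = n].
have eP i : D i -> e (f i) = i.
  move=> Di; rewrite /e; case: xgetP => [j _ [Dj fji]|/(_ i)[]//].
  by apply: finj => //; exact/mem_set.
exists (f @` D), e; split.
- by move=> _ [i Di <-]; rewrite eP.
- move=> _ _ /set_mem[i Di <-] /set_mem[j Dj <-].
  by rewrite !eP// => ->.
- by move=> i Di; exists (f i); [exists i|exact: eP].
Qed.

Lemma esum_enum (I : choiceType) (D : set I) (B : set nat) (e : nat -> I)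
    (u : I -> \bar R) : set_bij B D e -> (forall i, D i -> 0 <= u i) ->
  \esum_(i in D) u i = \sum_(n <oo) (if n \in B then u (e n) else 0).
Proof.
move=> bij_e u0; rewrite (reindex_esum _ _ _ _ bij_e) esum_mkcond.
rewrite nneseries_esumT// => n; case: ifPn => // /set_mem nB.
by apply: u0; exact: (set_bij_homo bij_e).
Qed.

End Sums.

Section SumsIntegrals.
Context d (T : measurableType d) (R : realType).
Variable mu : {measure set T -> \bar R}.
Local Open Scope ereal_scope.

(** The integral of a nonnegative function is a supremum over the simple
functions below it, so monotonicity holds without measurability. This spares a proof
that the measure of a ball is a measurable function of its center and radius:
the Sobolev integrand is only compared with explicit measurable functions. *)
Lemma ge0_integral_mono (D : set T) (f g : T -> \bar R) :
  (forall x, D x -> 0 <= f x) -> (forall x, D x -> f x <= g x) ->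
  \int[mu]_(x in D) f x <= \int[mu]_(x in D) g x.
Proof.
move=> f0 fg; have g0 x : D x -> 0 <= g x.
  by move=> Dx; exact: le_trans (f0 x Dx) (fg x Dx).
rewrite !ge0_integralE//; apply: le_ereal_sup => _ [h hf <-].
exists h => // x; apply: le_trans (hf x) _.
by rewrite /patch; case: ifPn => // /set_mem /fg.
Qed.

Section countable_sum.
Context (I : choiceType) (D : set I) (A : set T) (f : I -> T -> \bar R).
Hypotheses (cD : countable D) (mA : measurable A).
Hypothesis mf : forall i, D i -> measurable_fun A (f i).
Hypothesis f0 : forall i x, D i -> 0 <= f i x.

Lemma measurable_esum : measurable_fun A (fun x => \esum_(i in D) f i x).
Proof.
have [->|/set0P D0] := eqVneq D set0.
  by under eq_fun do rewrite esum_set0; exact: measurable_cst.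
have [B [e bij_e]] := countable_enum cD D0.
have enumE x : \esum_(i in D) f i x =
    \sum_(n <oo) (if n \in B then f (e n) x else 0).
  by apply: esum_enum => // i Di; exact: f0.
under eq_fun do rewrite enumE.
apply: (ge0_emeasurable_sum (h := fun n x => if n \in B then f (e n) x else 0)
  (P := xpredT)).
  move=> n x Ax _; case: ifPn => // /set_mem Bn; apply: f0.
  exact: (set_bij_homo bij_e).
move=> n _; case: (boolP (n \in B)) => [/set_mem Bn|_] //.
by apply: mf; exact: (set_bij_homo bij_e).
Qed.

Lemma integral_esum :
  \int[mu]_(x in A) (\esum_(i in D) f i x) =
  \esum_(i in D) \int[mu]_(x in A) f i x.
Proof.
have [->|/set0P D0] := eqVneq D set0.
  by under eq_integral do rewrite esum_set0; rewrite integral0 esum_set0.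
have [B [e bij_e]] := countable_enum cD D0.
have enumE x : \esum_(i in D) f i x =
    \sum_(n <oo) (if n \in B then f (e n) x else 0).
  by apply: esum_enum => // i Di; exact: f0.
under eq_integral do rewrite enumE.
rewrite (esum_enum bij_e); last by move=> i Di; apply: integral_ge0 => x _; exact: f0.
rewrite integral_nneseries//.
- apply: eq_eseriesr => n _.
  by case: (boolP (n \in B)) => // _; rewrite integral0.
- move=> n; case: (boolP (n \in B)) => [/set_mem Bn|_] //.
  by apply: mf; exact: (set_bij_homo bij_e).
- move=> n x Ax; case: ifPn => // /set_mem Bn; apply: f0.
  exact: (set_bij_homo bij_e).
Qed.

End countable_sum.

Lemma esum_measure_le (I : choiceType) (D : set I) (F : I -> set T) (A : set T) :
  measurable A -> (forall i, D i -> measurable (F i)) ->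
  (forall i, D i -> F i `<=` A) -> trivIset D F ->
  \esum_(i in D) mu (F i) <= mu A.
Proof.
move=> mA mF FA tF; apply: ge_ereal_sup => _ [X [finX XD] <-].
rewrite -measure_fin_bigcup//.
- apply: le_measure; rewrite ?inE//.
    by apply: fin_bigcup_measurable => // i /XD; exact: mF.
  by move=> x [i /XD Di]; exact: FA.
- by apply: sub_trivIset tF.
- by move=> i /XD; exact: mF.
Qed.

Lemma measure_le_esum (I : choiceType) (D : set I) (F : I -> set T) (A : set T) :
  countable D -> measurable A -> (forall i, D i -> measurable (F i)) ->
  A `<=` \bigcup_(i in D) F i ->
  mu A <= \esum_(i in D) mu (A `&` F i).
Proof.
move=> cD mA mF AF.
have -> : mu A = \int[mu]_x (\1_A x)%:E by rewrite integral_indic// setIT.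
have -> : \esum_(i in D) mu (A `&` F i) =
    \esum_(i in D) \int[mu]_x (\1_(A `&` F i) x)%:E.
  apply: eq_esum => i Di; rewrite integral_indic ?setIT//.
  by apply: measurableI => //; exact: mF.
rewrite -integral_esum//; last first.
  move=> i Di; apply/measurable_EFinP; apply: measurable_indic.
  by apply: measurableI => //; exact: mF.
apply: ge0_integral_mono => x _; first by rewrite lee_fin.
have [Ax|nAx] := pselect (A x); last first.
  by rewrite indicE memNset//; apply: esum_ge0 => i _; rewrite lee_fin.
have [i Di Fi] := AF x Ax.
apply: (@le_trans _ _ (\esum_(j in [set i]) (\1_(A `&` F j) x)%:E)).
  by rewrite esum_set1 ?lee_fin// !indicE !mem_set.
by apply: le_esum_subset => _ ->.
Qed.

End SumsIntegrals.

(** * Cubes and the Euclidean norm *)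

Section Geometry.
Context {R : realType} {n : nat}.
Implicit Types (x y z w : 'rV[R]_n) (Q P : cube R n) (r h : R).

Lemma coord_le_enorm x i : `|x ord0 i| <= enorm x.
Proof.
rewrite -sqrtr_sqr ler_wsqrtr// (bigD1 i)//= lerDl.
by apply: sumr_ge0 => j _; rewrite sqr_ge0.
Qed.

(** The constant [n] is not the best one, [sqrt n], but it stays rational. *)
Lemma enorm_le x h : 0 <= h -> (forall i, `|x ord0 i| <= h) ->
  enorm x <= n%:R * h.
Proof.
move=> h0 xh; have nh0 : 0 <= n%:R * h by rewrite mulr_ge0.
rewrite -(ger0_norm nh0) -sqrtr_sqr ler_wsqrtr//.
apply: (@le_trans _ _ (\sum_(i < n) h ^+ 2)).
  apply: ler_sum => i _; rewrite -(real_normK (num_real (x ord0 i))).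
  by rewrite lerXn2r// ?nnegrE.
rewrite sumr_const card_ord exprMn -[leLHS]mulr_natl ler_wpM2r ?sqr_ge0//.
case: (n) => [|k]; first by rewrite expr0n.
by rewrite expr2 ler_peMl// ler1n.
Qed.

Lemma enormN x : enorm (- x) = enorm x.
Proof. by congr Num.sqrt; apply: eq_bigr => i _; rewrite mxE sqrrN. Qed.

Lemma enormB x y : enorm (x - y) = enorm (y - x).
Proof. by rewrite -enormN opprB. Qed.

Lemma enorm_ge0 x : 0 <= enorm x. Proof. exact: sqrtr_ge0. Qed.

Lemma enorm_gt0 x : x != 0 -> 0 < enorm x.
Proof.
move=> x0; rewrite lt_neqAle enorm_ge0 andbT eq_sym; apply: contra x0.
move=> /eqP ex; apply/eqP/rowP => i; rewrite mxE; apply/eqP.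
by rewrite -normr_le0 -ex coord_le_enorm.
Qed.

Lemma measurable_halfspace i r :
  measurable ([set x | x ord0 i < r] : set (borelRn R n)).
Proof.
apply: sub_sigma_algebra.
apply: (@open_comp _ _ (fun x : 'rV[R]_n => x ord0 i) [set t | t < r]).
  by move=> x _; exact: coord_continuous.
exact: open_lt.
Qed.

Lemma measurable_cube_set Q : measurable (cube_set Q : set (borelRn R n)).
Proof.
have -> : cube_set Q = \bigcap_(i in [set: 'I_n])
    (~` [set x | x ord0 i < corner Q ord0 i] `&`
     [set x | x ord0 i < corner Q ord0 i + side Q]).
  apply/seteqP; split => [x Qx i _|x Qx i].
    by have /andP[a b] := Qx i; split => //=; apply/negP; rewrite -leNgt.
  by have [/negP a b] := Qx i I; rewrite leNgt a.
apply: fin_bigcap_measurable => // i _; apply: measurableI.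
  by apply: measurableC; exact: measurable_halfspace.
exact: measurable_halfspace.
Qed.

Lemma enorm_continuous : continuous (@enorm R n).
Proof.
have sqc : continuous (fun x : 'rV[R]_n => \sum_(i < n) x ord0 i ^+ 2 : R).
  apply: continuous_big => [|i _]; first exact: add_continuous.
  move=> x; apply: (@continuous_comp _ _ _ (fun y : 'rV[R]_n => y ord0 i)
    (fun t => t ^+ 2)); first exact: coord_continuous.
  exact: exprn_continuous.
by move=> x; apply: continuous_comp; [exact: sqc|exact: sqrt_continuous].
Qed.

Lemma measurable_eball x r : measurable (eball x r : set (borelRn R n)).
Proof.
apply: sub_sigma_algebra.
apply: (@open_comp _ _ (fun y => enorm (y - x)) [set t | t < r]).
  move=> y _; apply: (@continuous_comp _ _ _ (fun y => y - x) (@enorm R n)).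
    by apply: (@continuousB _ _ _ id (cst x)); [exact: cvg_id|exact: cst_continuous].
  exact: enorm_continuous.
exact: open_lt.
Qed.

(** Cubes given by center and half-side, for which doubling is a dilation. *)
Definition ccube z r : cube R n := (z - const_mx r, 2 * r).

Definition center Q : 'rV[R]_n := corner Q + const_mx (side Q / 2).

Lemma mem_ccube z r w :
  cube_set (ccube z r) w <-> forall i, z ord0 i - r <= w ord0 i < z ord0 i + r.
Proof.
have e1 i : corner (ccube z r) ord0 i = z ord0 i - r.
  by rewrite /corner /= !mxE.
have e2 i : corner (ccube z r) ord0 i + side (ccube z r) = z ord0 i + r.
  by rewrite e1 /side /=; ring.
by split => H i; have := H i; rewrite e2 e1.
Qed.

Lemma ccube_center Q : ccube (center Q) (side Q / 2) = Q.
Proof.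
case: Q => c l; rewrite /ccube /center /corner /side /= addrK.
by congr pair; field.
Qed.

Lemma double_ccube z r : Defs.double (ccube z r) = ccube z (2 * r).
Proof.
rewrite /Defs.double /ccube /corner /side /=; congr pair.
by rewrite -addrA -opprD; congr (_ - _); apply/rowP => i; rewrite !mxE; field.
Qed.

Lemma subset_ccube z (r r' : R) : r <= r' ->
  cube_set (ccube z r) `<=` cube_set (ccube z r').
Proof.
move=> rr x /mem_ccube xz; apply/mem_ccube => i; have /andP[a b] := xz i.
by apply/andP; split; lra.
Qed.

Lemma cube_near_center Q x i : 0 < side Q -> cube_set Q x ->
  `|x ord0 i - center Q ord0 i| <= side Q / 2.
Proof.
move=> Q0 /(_ i)/andP[a b]; rewrite !mxE ler_norml; apply/andP; split; lra.
Qed.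

Lemma cube_dist Q x y i : cube_set Q x -> cube_set Q y ->
  `|x ord0 i - y ord0 i| < side Q.
Proof.
by move=> /(_ i)/andP[a b] /(_ i)/andP[c d]; rewrite ltr_norml; apply/andP; split; lra.
Qed.

End Geometry.

(** * Doubling measures *)

Lemma expr_unbounded (R : realType) (x q : R) : 1 < q -> exists N, x <= q ^+ N.
Proof.
move=> q1; have a0 : 0 < q - 1 by lra.
have bern N : 1 + N%:R * (q - 1) <= q ^+ N.
  elim: N => [|N IH]; first by rewrite mul0r addr0.
  have N0 : 0 <= N%:R * (q - 1) by rewrite mulr_ge0// ltW.
  by rewrite exprS -natr1; nra.
exists (Num.bound (`|x| / (q - 1))); apply: le_trans (bern _).
have := archi_boundP (divr_ge0 (normr_ge0 x) (ltW a0)).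
by rewrite ltr_pdivrMr// => /ltW; have := ler_norm x; lra.
Qed.

Lemma doubling_ge1 (R : realType) n (mu : {measure set (borelRn R n) -> \bar R}) :
  doubling mu -> exists2 C : R, 1 <= C & forall Q : cube R n, 0 < side Q ->
    (mu (cube_set (Defs.double Q)) <= C%:E * mu (cube_set Q))%E.
Proof.
move=> [C muC]; exists (Num.max 1 C); first by rewrite le_max lexx.
move=> Q Q0; apply: le_trans (muC Q Q0) _.
by rewrite lee_wpmul2r// lee_fin le_max lexx orbT.
Qed.

Section Doubling.
Context (R : realType) (n : nat) (mu : {measure set (borelRn R n) -> \bar R}).
Variable C : R.
Hypothesis C_ge1 : 1 <= C.
Hypothesis muC : forall Q : cube R n, 0 < side Q ->
  (mu (cube_set (Defs.double Q)) <= C%:E * mu (cube_set Q))%E.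
Hypothesis mu_lf : locally_finite_measure mu.
Implicit Types (x y z w : 'rV[R]_n) (Q P : cube R n) (r h : R).

Let C_ge0 : 0 <= C. Proof. exact: le_trans C_ge1. Qed.

Lemma doubling_iter z r M : 0 < r ->
  (mu (cube_set (ccube z (2 ^+ M * r))) <=
     (C ^+ M)%:E * mu (cube_set (ccube z r)))%E.
Proof.
move=> r0; elim: M => [|M IH]; first by rewrite !expr0 mul1r mul1e.
rewrite exprS -mulrA -double_ccube; apply: le_trans (muC _) _.
  by rewrite /side /= mulr_gt0// mulr_gt0// exprn_gt0.
by rewrite exprS EFinM -muleA lee_wpmul2l// lee_fin.
Qed.

(** The form in which doubling is used: sets trapped between two concentric
cubes have comparable measures. *)
Lemma doubling_compare z r M (A B : set 'rV[R]_n) : 0 < r ->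
  measurable (A : set (borelRn R n)) -> measurable (B : set (borelRn R n)) ->
  A `<=` cube_set (ccube z (2 ^+ M * r)) -> cube_set (ccube z r) `<=` B ->
  (mu A <= (C ^+ M)%:E * mu B)%E.
Proof.
move=> r0 mA mB AQ QB.
apply: (@le_trans _ _ (mu (cube_set (ccube z (2 ^+ M * r))))).
  by apply: le_measure; rewrite ?inE//; exact: measurable_cube_set.
apply: le_trans (doubling_iter _ _ r0) _.
rewrite lee_wpmul2l ?lee_fin ?exprn_ge0//.
by apply: le_measure; rewrite ?inE//; exact: measurable_cube_set.
Qed.

Lemma cube_sub_ccube Q z : exists2 r, 0 < r & cube_set Q `<=` cube_set (ccube z r).
Proof.
exists (enorm (corner Q - z) + `|side Q| + 1).
  by rewrite ltr_wpDl// addr_ge0// enorm_ge0.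
move=> x Qx; apply/mem_ccube => i; have /andP[a b] := Qx i.
have := coord_le_enorm (corner Q - z) i; rewrite !mxE ler_norml => /andP[c d].
have := ler_norm (side Q); have := normr_ge0 (side Q).
by move=> e f; apply/andP; split; lra.
Qed.

Lemma ccube_sub_pow z r e : 0 < e ->
  exists M, cube_set (ccube z r) `<=` cube_set (ccube z (2 ^+ M * e)).
Proof.
move=> e0; have two1 : (1 : R) < 2 by rewrite ltr1n.
have [M hM] := expr_unbounded (r / e) two1; exists M.
by apply: subset_ccube; rewrite -ler_pdivrMr.
Qed.

(** Local finiteness gives one small cube of finite measure around the origin,
and doubling spreads finiteness to all larger cubes around it. *)
Lemma mu_cube_fin Q : (mu (cube_set Q) < +oo)%E.
Proof.
have [U [oU U0] Ufin] := mu_lf 0.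
have [e /= e0 eU] : exists2 e : R, 0 < e & ball (0 : 'rV[R]_n) e `<=` U.
  by apply/nbhs_ballP; exact: open_nbhs_nbhs.
have [r r0 Qr] := cube_sub_ccube Q 0.
have e20 : 0 < e / 2 by rewrite divr_gt0.
have [M rM] := ccube_sub_pow 0 r e20.
apply: le_lt_trans (doubling_compare (B := U) e20 _ _ (subset_trans Qr rM) _) _.
- exact: measurable_cube_set.
- exact: sub_sigma_algebra.
- move=> x /mem_ccube xe; apply: eU; split => // i j; rewrite (ord1 i).
  have := xe j; rewrite !mxE sub0r add0r /ball /= sub0r normrN ltr_norml.
  by move=> /andP[a b]; apply/andP; split; lra.
- by rewrite lte_mul_pinfty// ?lee_fin ?exprn_ge0.
Qed.

(** If one cube were null then so would be all its dilates, which exhaust the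
space. *)
Lemma mu_cube_gt0 Q : mu setT != 0%E -> 0 < side Q -> (0 < mu (cube_set Q))%E.
Proof.
move=> muT Q0; rewrite lt_neqAle measure_ge0 andbT eq_sym.
apply: contra muT => /eqP muQ0; apply/eqP.
have Q20 : 0 < side Q / 2 by rewrite divr_gt0.
have zero M : mu (cube_set (ccube (center Q) (2 ^+ M * (side Q / 2)))) = 0%E.
  apply/eqP; rewrite eq_le measure_ge0 andbT.
  by apply: le_trans (doubling_iter _ _ Q20) _; rewrite ccube_center muQ0 mule0.
have -> : [set: 'rV[R]_n] =
    \bigcup_M cube_set (ccube (center Q) (2 ^+ M * (side Q / 2))).
  apply/seteqP; split => // x _.
  have [r r0 xr] := cube_sub_ccube (x, 1) (center Q).
  have [M rM] := ccube_sub_pow (center Q) r Q20.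
  by exists M => //; apply/rM/xr => i; rewrite lexx ltrDl /side /= ltr01.
apply: measure_negligible.
  by apply: bigcup_measurable => M _; exact: measurable_cube_set.
apply: negligible_bigcup => M; apply/negligibleP; last exact: zero.
exact: measurable_cube_set.
Qed.

End Doubling.

(** * Dyadic grids *)

Section Grid.
Context (R : realType) (n : nat).
Hypothesis n_gt0 : (0 < n)%N.
Implicit Types (x y z w : 'rV[R]_n) (Q P S : cube R n) (r h : R).

Lemma corner_mem Q : 0 < side Q -> cube_set Q (corner Q).
Proof. by move=> Q0 i; rewrite lexx ltrDl. Qed.

Lemma subset_side Q P : 0 < side Q -> cube_set Q `<=` cube_set P ->
  side Q <= side P.
Proof.
move=> Q0 QP; rewrite leNgt; apply/negP => PQ.
pose i := Ordinal n_gt0.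
have /andP[a b] := QP _ (corner_mem Q0) i.
have P0 : 0 <= side P by lra.
have : cube_set P (corner Q + const_mx (side P)).
  by apply: QP => j; rewrite !mxE lerDl P0 /= ltrD2l.
by move=> /(_ i); rewrite !mxE => /andP[c d]; lra.
Qed.

Variable D : set (cube R n).
Hypothesis gD : dyadic_grid D.

Lemma grid_side_gt0 Q : D Q -> 0 < side Q.
Proof. by case: gD => lev _ _ /lev[k ->]; exact: exprz_gt0. Qed.

Lemma grid_cell (k : int) x : exists Q, [/\ D Q, side Q = 2 ^ k & cube_set Q x].
Proof.
case: gD => _ /(_ k)[cov _ _] _.
have [Q [DQ sQ] Qx] : cover [set Q | D Q /\ side Q = 2 ^ k] (@cube_set R n) x.
  by rewrite cov.
by exists Q.
Qed.

Lemma grid_level_inj Q P x : D Q -> D P -> side Q = side P ->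
  cube_set Q x -> cube_set P x -> Q = P.
Proof.
move=> DQ DP QP Qx Px; have [lev part _] := gD.
have [k sQ] := lev Q DQ; have [_ triv _] := part k.
by apply: triv; [split|rewrite /= -QP; split|exists x].
Qed.

Lemma grid_nested Q P x : D Q -> D P -> side Q <= side P ->
  cube_set Q x -> cube_set P x -> cube_set Q `<=` cube_set P.
Proof.
move=> DQ DP QP Qx Px; have [_ _ /(_ Q P DQ DP)[//|PQ|QP0]] := gD.
  rewrite (@grid_level_inj Q P x)//; apply/eqP; rewrite eq_le QP /=.
  by apply: subset_side => //; exact: grid_side_gt0.
by have : (cube_set Q `&` cube_set P) x by []; rewrite QP0.
Qed.

(** Two cubes of the same side whose corners have the same integer part, in
units of that side, intersect; in a grid they are equal. *)
Lemma grid_countable : countable D.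
Proof.
pose lev Q : int := xget 0 [set k | side Q = 2 ^ k].
have levE Q : D Q -> side Q = 2 ^ lev Q.
  move=> DQ; rewrite /lev; case: xgetP => [k _ ->//|].
  by have [/(_ Q DQ)[k sQ] _ _] := gD => /(_ k).
pose pos Q := (lev Q, [ffun i => Num.floor (corner Q ord0 i / side Q)]).
apply/countable_injP; exists (choice.pickle \o pos).
move=> Q P /set_mem DQ /set_mem DP /(pcan_inj choice.pickleK)[lQP fQP].
have sQP : side Q = side P by rewrite !levE// lQP.
have s0 := grid_side_gt0 DQ.
have near i : `|corner Q ord0 i - corner P ord0 i| < side Q.
  move/ffunP/(_ i) : fQP; rewrite !ffunE -sQP => fi.
  have := floor_itv (corner Q ord0 i / side Q).
  have := floor_itv (corner P ord0 i / side Q).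
  rewrite -fi; set m := _%:~R; rewrite intrD -/m !ler_pdivlMr// !ltr_pdivrMr//.
  by move=> /andP[a b] /andP[c d]; rewrite ltr_norml; apply/andP; split; lra.
apply: (@grid_level_inj Q P
  (\row_i Num.max (corner Q ord0 i) (corner P ord0 i))) => // i.
  rewrite mxE le_max lexx gt_max ltrDl s0 /=.
  by have := near i; rewrite ltr_norml => /andP[a b]; lra.
rewrite mxE le_max lexx orbT gt_max -sQP ltrDl s0 andbT /=.
by have := near i; rewrite ltr_norml => /andP[a b]; lra.
Qed.

(** The grid only provides the existence of the cube of the next generation
containing [Q], so it is selected by choice; [(0, 1)] is a dummy value. *)
Definition parent Q : cube R n := xget (0, 1)
  [set P | [/\ D P, side P = 2 * side Q & cube_set Q `<=` cube_set P]].

Lemma parentP Q : D Q -> [/\ D (parent Q), side (parent Q) = 2 * side Q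
  & cube_set Q `<=` cube_set (parent Q)].
Proof.
move=> DQ; rewrite /parent; case: xgetP => [P _ //|/= noP].
have [lev _ _] := gD; have [k sQ] := lev Q DQ.
have [P [DP sP Px]] := grid_cell (k + 1) (corner Q).
have Q0 := grid_side_gt0 DQ.
have sP2 : side P = 2 * side Q.
  by rewrite sP sQ expfzDr// expr1z mulrC.
case: (noP P); split => //; apply: (@grid_nested _ _ (corner Q)) => //.
  by rewrite sP2; lra.
exact: corner_mem.
Qed.

Definition ancestor j Q := iter j parent Q.

Lemma ancestorP j Q : D Q -> [/\ D (ancestor j Q),
  side (ancestor j Q) = 2 ^+ j * side Q
  & cube_set Q `<=` cube_set (ancestor j Q)].
Proof.
move=> DQ; elim: j => [|j [DA sA QA]]; first by split; rewrite ?mul1r.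
have [DP sP AP] := parentP DA; split => //.
  by rewrite [side _]sP sA exprS mulrA.
exact: subset_trans QA AP.
Qed.

(** The ancestors of a cube [Q] containing [x] are all the larger cubes of the
grid that contain [x]. *)
Lemma ancestor_eq j Q P x : D Q -> D P -> side P = 2 ^+ j * side Q ->
  cube_set Q x -> cube_set P x -> P = ancestor j Q.
Proof.
move=> DQ DP sP Qx Px; have [DA sA QA] := ancestorP j DQ.
by apply: (@grid_level_inj _ _ x) => //; [rewrite sP sA|exact: QA].
Qed.

End Grid.

(** * Boundary layers of dyadic cubes *)

Section Halo.
Context (R : realType) (n : nat).
Implicit Types (x y z w : 'rV[R]_n) (Q P S : cube R n) (r h : R).

Definition shrink Q h : cube R n := (corner Q + const_mx h, side Q - 2 * h).

(** The boundary layer of width [h] of [Q], measured in the sup norm. *)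
Definition halo Q h := cube_set Q `\` cube_set (shrink Q h).

(** This description by points outside [Q] makes the layers easy to compare
for nested cubes: a point outside [Q] is also outside every subcube of [Q]. *)
Lemma haloP Q h x : 0 <= h -> halo Q h x <->
  cube_set Q x /\ exists2 y, ~ cube_set Q y & forall i, `|x ord0 i - y ord0 i| <= h.
Proof.
move=> h0; split => [[Qx nx]|[Qx [y nQy xy]]]; split => //.
  move/existsNP : nx => [i nxi].
  (* move [x] by [h] across the face it is close to *)
  pose s : R := if x ord0 i < corner Q ord0 i + h then - h else h.
  exists (x + \row_j (if j == i then s else 0)).
    move=> /(_ i); rewrite !mxE eqxx => /andP[a b]; apply: nxi.
    rewrite /shrink /corner /side !mxE /= -/(corner Q) -/(side Q).
    have /andP[c d] := Qx i.
    move: a b; rewrite /s; case: ifPn => [|/negPf]; first by lra.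
    by rewrite ltNge => /negbFE e a b; apply/andP; split; lra.
  move=> j; rewrite !mxE opprD addNKr normrN; case: eqP; rewrite ?normr0// => _.
  by rewrite /s; case: ifP; rewrite ?normrN ger0_norm.
move=> sx; apply: nQy => i; have := sx i.
rewrite /shrink /corner /side !mxE /= -/(corner Q) -/(side Q).
by have := xy i; rewrite ler_norml => /andP[a b] /andP[c d]; apply/andP; split; lra.
Qed.

(** The concentric double of the inner half of a cube is the cube itself, so
that doubling bounds from below the share of the inner half. *)
Lemma double_shrink Q h : side Q = 4 * h -> Defs.double (shrink Q h) = Q.
Proof.
case: Q => c l; rewrite /side /= => ->.
rewrite /Defs.double /shrink /corner /side /=; congr pair; last by ring.
by apply/rowP => i; rewrite !mxE; field.
Qed.

Lemma measurable_halo Q h : measurable (halo Q h : set (borelRn R n)).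
Proof. by apply: measurableD; exact: measurable_cube_set. Qed.

Variable mu : {measure set (borelRn R n) -> \bar R}.
Variable C : R.
Hypothesis C_ge1 : 1 <= C.
Hypothesis muC : forall Q : cube R n, 0 < side Q ->
  (mu (cube_set (Defs.double Q)) <= C%:E * mu (cube_set Q))%E.
Hypothesis mu_lf : locally_finite_measure mu.
Hypothesis n_gt0 : (0 < n)%N.

Let C_gt0 : 0 < C. Proof. exact: lt_le_trans C_ge1. Qed.
Let C_ge0 : 0 <= C. Proof. exact: ltW. Qed.

Lemma halo_shell P h : 0 < h -> side P = 4 * h ->
  (mu (halo P h) <= (1 - C^-1)%:E * mu (cube_set P))%E.
Proof.
move=> h0 sP.
have mS := measurable_cube_set (shrink P h); have mP := measurable_cube_set P.
have finP := mu_cube_fin C_ge1 muC mu_lf P.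
have sub : cube_set (shrink P h) `<=` cube_set P.
  move=> x sx i; have := sx i.
  rewrite /shrink /corner /side !mxE /= -/(corner P) -/(side P).
  by move=> /andP[a b]; apply/andP; split; lra.
have -> : (mu (halo P h) = mu (cube_set P) - mu (cube_set (shrink P h)))%E.
  rewrite measureD//; congr (_ - mu _)%E; exact/setIidPr.
have finS := mu_cube_fin C_ge1 muC mu_lf (shrink P h).
have := muC (Q := shrink P h); rewrite double_shrink// => muP.
have /muP : 0 < side (shrink P h).
  have -> : side (shrink P h) = side P - 2 * h by [].
  by lra.
have [p [s [-> ->]]] : exists p s : R,
    mu (cube_set P) = p%:E /\ mu (cube_set (shrink P h)) = s%:E.
  exists (fine (mu (cube_set P))), (fine (mu (cube_set (shrink P h)))).
  by rewrite !fineK// ge0_fin_numE.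
rewrite -EFinB -!EFinM !lee_fin => ps.
rewrite mulrBl mul1r lerD2l lerN2 mulrC ler_pdivrMr// mulrC; exact: ps.
Qed.

Variable D : set (cube R n).
Hypothesis gD : dyadic_grid D.

(** The layer of width [h] is covered by the cubes of side [4 h] of the grid
that meet it. Each of them loses a fixed proportion of its mass, its inner
half, because the layer of [Q] inside a subcube [P] lies in the layer of [P];
and all of them are contained in the layer of width [8 h]. *)
Lemma halo_step Q (k : int) h : D Q -> 4 * h = 2 ^ k -> 4 * h <= side Q ->
  (mu (halo Q h) <= (1 - C^-1)%:E * mu (halo Q (8 * h)))%E.
Proof.
move=> DQ hk hQ.
have h0 : 0 < h by rewrite -(@pmulr_rgt0 _ 4)// hk exprz_gt0.
pose E := [set P | [/\ D P, side P = 4 * h & cube_set P `&` halo Q h !=set0]].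
have subQ P : E P -> cube_set P `<=` cube_set Q.
  move=> [DP sP [x [Px [Qx _]]]]; apply: (grid_nested n_gt0 gD (x := x)) => //.
  by rewrite sP.
have cE : countable E.
  by apply: sub_countable (grid_countable gD); apply: subset_card_le => P [].
have cov : halo Q h `<=` \bigcup_(P in E) cube_set P.
  move=> x hx; have [P [DP sP Px]] := grid_cell gD k x.
  by exists P => //; split; rewrite ?sP//; exists x.
apply: le_trans (measure_le_esum mu cE (measurable_halo Q h) _ cov) _.
  by move=> P _; exact: measurable_cube_set.
apply: (@le_trans _ _ (\esum_(P in E) ((1 - C^-1)%:E * mu (cube_set P)))%E).
  apply: le_esum => P EP; have [DP sP _] := EP.
  apply: le_trans (halo_shell h0 sP).
  apply: le_measure; rewrite ?inE.
  - by apply: measurableI; [exact: measurable_halo|exact: measurable_cube_set].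
  - exact: measurable_halo.
  - move=> x [/(haloP Q x (ltW h0))[Qx [y nQy xy]] Px].
    by apply/(haloP P x (ltW h0)); split => //; exists y => // /(subQ P EP).
rewrite esumZl//; last by rewrite subr_ge0 invf_le1.
rewrite lee_wpmul2l ?lee_fin ?subr_ge0 ?invf_le1//.
apply: esum_measure_le => //.
- exact: measurable_halo.
- by move=> P _; exact: measurable_cube_set.
- move=> P EP x Px; have [DP sP [w [Pw hw]]] := EP.
  have /(haloP Q w (ltW h0))[Qw [y nQy wy]] := hw.
  apply/haloP; first by lra.
  split; first exact: (subQ P EP).
  exists y => // i.
  have := wy i; have := cube_dist i Px Pw; rewrite sP ltr_norml !ler_norml.
  by move=> /andP[a b] /andP[c d]; apply/andP; split; lra.
- move=> P P' [DP sP _] [DP' sP' _] [x [Px P'x]].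
  by apply: (grid_level_inj gD DP DP' _ Px P'x); rewrite sP.
Qed.

(** By [halo_step], three halvings of the width multiply the measure of the
layer by at most [1 - C^-1]; [decay] replaces the cube root of this factor by
a slightly larger number that is rational in [C]. *)
Definition decay : R := 1 - (3 * C)^-1.

Lemma decay_bounds : 2 / 3 <= decay /\ decay < 1.
Proof.
have c1 : 0 < (3 * C)^-1 by rewrite invr_gt0 mulr_gt0.
have c2 : (3 * C)^-1 <= 3^-1.
  by rewrite lef_pV2 ?posrE ?mulr_gt0// ler_peMr.
by rewrite /decay; split; lra.
Qed.

Lemma decay3 : 1 - C^-1 <= decay ^+ 3.
Proof.
have [d1 d2] := decay_bounds; move: d1 d2; rewrite /decay invfM.
set c := C^-1; set a := 3^-1 * c.
have -> : c = 3 * a by rewrite /a; field.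
by move=> d1 d2; rewrite !exprS expr0; nra.
Qed.

(** The factor [decay ^- 2] absorbs the first three widths, for which the
trivial bound by [mu Q] is used. *)
Lemma halo_decay Q j : D Q ->
  (mu (halo Q (side Q / 2 ^+ j)) <=
     (decay ^- 2 * decay ^+ j)%:E * mu (cube_set Q))%E.
Proof.
move=> DQ; have Q0 := grid_side_gt0 gD DQ.
have [d1 d2] := decay_bounds.
have d0 : 0 < decay by lra.
elim/ltn_ind: j => j IH; have [j3|j3] := ltnP j 3.
  apply: (@le_trans _ _ (mu (cube_set Q))).
    apply: le_measure; rewrite ?inE; [exact: measurable_halo| |by move=> x []].
    exact: measurable_cube_set.
  rewrite -[leLHS]mul1e lee_wpmul2r// lee_fin.
  rewrite mulrC ler_pdivlMr ?exprn_gt0// mul1r.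
  by apply: ler_wiXn2l; rewrite ?ltW.
have [lev _ _] := gD; have [k sQ] := lev Q DQ.
have p2 : (0 : R) < 2 ^+ (j - 3) by rewrite exprn_gt0.
have e8 : 8 * (side Q / 2 ^+ j) = side Q / 2 ^+ (j - 3).
  rewrite -[in LHS](subnKC j3) exprD; field.
  by rewrite gt_eqF.
have e4 : 4 * (side Q / 2 ^+ j) = side Q / (2 * 2 ^+ (j - 3)).
  rewrite -[in LHS](subnKC j3) exprD; field.
  by rewrite gt_eqF.
apply: le_trans (@halo_step Q (k - (j - 3).+1%:Z) _ DQ _ _) _.
- by rewrite e4 sQ expfzDr// -exprS exprnN.
- rewrite e4 ler_pdivrMr ?mulr_gt0// ler_peMr// ?(ltW Q0)//.
  by rewrite -exprS exprn_ege1// ler1n.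
rewrite e8; have d3 := decay3.
apply: (@le_trans _ _ ((decay ^+ 3)%:E * mu (halo Q (side Q / 2 ^+ (j - 3))))%E).
  by rewrite lee_wpmul2r.
apply: (@le_trans _ _ ((decay ^+ 3)%:E *
    ((decay ^- 2 * decay ^+ (j - 3))%:E * mu (cube_set Q)))%E).
  rewrite lee_wpmul2l ?lee_fin ?exprn_ge0 ?(ltW d0)//.
  by apply: IH; rewrite ltn_subrL (leq_trans _ j3).
rewrite muleA -EFinM mulrCA -exprD subnKC//.
Qed.

(** Inside a cube at least three times as large as [Q] there is room for a
translate of [Q] by its own side along the first axis, in one of the two
directions; it is disjoint from [Q] and doubling makes its mass comparable. *)
Lemma growth_step Q P : 0 < side Q -> 3 * side Q <= side P ->
  cube_set Q `<=` cube_set P ->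
  ((1 + C ^- 2)%:E * mu (cube_set Q) <= mu (cube_set P))%E.
Proof.
move=> Q0 QP sub; pose i := Ordinal n_gt0; set l := side Q in Q0 QP *.
have := sub _ (corner_mem Q0) => PcQ; have /andP[a b] := PcQ i.
(* translate downwards if there is room below [Q], upwards otherwise *)
pose e : R := if corner P ord0 i + l <= corner Q ord0 i then - l else l.
have e_le : `|e| = l by rewrite /e; case: ifP; rewrite ?normrN gtr0_norm.
pose Q' : cube R n := (corner Q + e *: delta_mx ord0 i, l).
have Q'i x : cube_set Q' x -> corner Q ord0 i + e <= x ord0 i < corner Q ord0 i + e + l.
  by move=> /(_ i); rewrite /Q' /corner /side !mxE /= ?eqxx ?mulr1.
have Q'j x j : j != i -> cube_set Q' x ->
    corner Q ord0 j <= x ord0 j < corner Q ord0 j + l.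
  move=> ji /(_ j); rewrite /Q' /corner /side !mxE /=.
  by rewrite (negPf ji) mulr0 addr0.
have mQ := measurable_cube_set Q; have mQ' := measurable_cube_set Q'.
have Q'P : cube_set Q' `<=` cube_set P.
  move=> x Q'x j; have [->|ji] := eqVneq j i.
    have := Q'i x Q'x; rewrite /e; case: ifPn => [ab|].
      by move=> /andP[c d]; apply/andP; split; lra.
    by rewrite -ltNge => ab /andP[c d]; apply/andP; split; lra.
  pose y := \row_m (if m == i then corner Q ord0 i else x ord0 m).
  have Qy : cube_set Q y.
    move=> m; rewrite mxE; case: eqP => [->|/eqP mi]; first by rewrite lexx ltrDl.
    exact: Q'j.
  by have := sub _ Qy j; rewrite mxE (negPf ji).
have disj : cube_set Q `&` cube_set Q' = set0.
  apply/seteqP; split => // x [/(_ i) + /Q'i].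
  by rewrite -/l /e; case: ifP => _ /andP[c d] /andP[c' d']; lra.
have cmp : (mu (cube_set Q) <= (C ^+ 2)%:E * mu (cube_set Q'))%E.
  apply: (@doubling_compare _ _ mu C C_ge1 muC (center Q') (l / 2)) => //.
  - by rewrite divr_gt0.
  - move=> x Qx; apply/mem_ccube => j.
    have := Qx j; rewrite /center /Q' /corner /side !mxE /= -/(corner Q) -/(side Q) -/l.
    have : `|e * ((j == i)%:R)| <= l.
      rewrite normrM e_le; case: (j == i); rewrite ?normr1 ?normr0 ?mulr1//.
      by rewrite mulr0 ltW.
    rewrite -/(corner Q) ler_norml; set t := e * _.
    by move=> /andP[c d] /andP[c' d']; apply/andP; split; lra.
  - by rewrite -[l]/(side Q') ccube_center.
apply: (@le_trans _ _ (mu (cube_set Q `|` cube_set Q'))); last first.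
  apply: le_measure; rewrite ?inE; [exact: measurableU|exact: measurable_cube_set|].
  by rewrite subUset.
rewrite measureU// EFinD ge0_muleDl ?lee_fin ?invr_ge0 ?exprn_ge0//.
rewrite mul1e leeD2lE ?ge0_fin_numE//; last exact: (mu_cube_fin C_ge1 muC mu_lf).
by rewrite lee_pdivrMl// exprn_gt0.
Qed.

Lemma mu_ancestor_growth P (B : R) : mu setT != 0%E -> D P ->
  exists N, forall M, (N <= M)%N -> (B%:E <= mu (cube_set (ancestor D M P)))%E.
Proof.
move=> muT DP.
set q := 1 + C ^- 2.
have q1 : 1 < q by rewrite ltrDl invr_gt0 exprn_gt0.
have q0 : 0 < q by exact: lt_trans q1.
have geo j : ((q ^+ j)%:E * mu (cube_set P) <= mu (cube_set (ancestor D (2 * j) P)))%E.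
  elim: j => [|j IH]; first by rewrite expr0 muln0 mul1e lexx.
  have [DA sA PA] := ancestorP n_gt0 gD (2 * j) DP.
  have [DB sB AB] := ancestorP n_gt0 gD 2 DA.
  have -> : ancestor D (2 * j.+1) P = ancestor D 2 (ancestor D (2 * j) P).
    by rewrite /ancestor -iterD mulnS.
  have A0 := grid_side_gt0 gD DA.
  apply: le_trans (growth_step A0 _ AB); last by rewrite sB expr2; lra.
  rewrite exprS EFinM -muleA lee_wpmul2l// lee_fin; exact: ltW.
have mono M M' : (M <= M')%N ->
    (mu (cube_set (ancestor D M P)) <= mu (cube_set (ancestor D M' P)))%E.
  move=> MM; apply: le_measure; rewrite ?inE; [exact: measurable_cube_set..|].
  have [DA _ _] := ancestorP n_gt0 gD M DP.
  have [_ _] := ancestorP n_gt0 gD (M' - M) DA.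
  by rewrite /ancestor -iterD subnK.
have P0 := mu_cube_gt0 C_ge1 muC muT (grid_side_gt0 gD DP).
have finP := mu_cube_fin C_ge1 muC mu_lf P.
have [p muP] : exists p, mu (cube_set P) = p%:E.
  by exists (fine (mu (cube_set P))); rewrite fineK// ge0_fin_numE.
rewrite muP lte_fin in P0.
have [N qN] := expr_unbounded (B / p) q1.
exists (2 * N)%N => M NM; apply: le_trans (mono _ _ NM).
apply: le_trans (geo N); rewrite muP -EFinM lee_fin -ler_pdivrMr//.
Qed.

End Halo.

(** * Averages of square-integrable functions *)

Section L2.
Context d (T : measurableType d) (R : realType).
Variable mu : {measure set T -> \bar R}.
Variable f : T -> R.
Hypothesis f2 : f \in Lfun mu 2%:E.

Lemma Lfun_measurable : measurable_fun setT f.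
Proof. by move: f2; rewrite inE => /andP[+ _]; rewrite inE. Qed.

Lemma measurable_sqrB (A : set T) (c : R) :
  measurable_fun A (fun x => ((f x - c) ^+ 2)%:E).
Proof.
apply/measurable_EFinP/measurable_funX/measurable_funB => //.
exact: measurable_funS Lfun_measurable.
Qed.

Section finite_set.
Variable A : set T.
Hypotheses (mA : measurable A) (finA : (mu A < +oo)%E).

Lemma integrable_cst_fin (c : R) : mu.-integrable A (EFin \o cst c).
Proof.
apply: measurable_bounded_integrable => //.
exact: (@bounded_cst _ R).
Qed.

Lemma Lfun2_integrable : mu.-integrable A (EFin \o f).
Proof.
have i2 : mu.-integrable A (EFin \o (fun x => f x ^+ 2)).
  exact: integrableS (Lfun2_integrable_sqr f2).
apply: le_integrable (integrableD mA i2 (integrable_cst_fin 1)) => //.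
  by apply/measurable_EFinP; exact: measurable_funS Lfun_measurable.
move=> x Ax /=; rewrite lee_fin [leRHS]ger0_norm ?addr_ge0 ?sqr_ge0//.
by rewrite -(real_normK (num_real (f x))); have := normr_ge0 (f x); nra.
Qed.

Lemma integrable_sqrB (c : R) :
  mu.-integrable A (EFin \o (fun x => (f x - c) ^+ 2)).
Proof.
have i2 : mu.-integrable A (EFin \o (fun x => f x ^+ 2)).
  exact: integrableS (Lfun2_integrable_sqr f2).
have i2' := integrableZl mA 2 i2.
apply: le_integrable (integrableD mA i2' (integrable_cst_fin (2 * c ^+ 2))) => //.
  exact: measurable_sqrB.
move=> x Ax /=; rewrite lee_fin [leLHS]ger0_norm ?sqr_ge0//.
by apply: le_trans (ler_norm _); have := sqr_ge0 (f x + c); nra.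
Qed.

Let E : R := (\int[mu]_(x in A) f x) / fine (mu A).

(** Integrate the tangent line inequality
[(f x - c) ^ 2 >= 2 * (E - c) * (f x - c) - (E - c) ^ 2]. *)
Lemma jensen_sqr (c : R) :
  ((fine (mu A) * (E - c) ^+ 2)%:E <= \int[mu]_(x in A) ((f x - c) ^+ 2)%:E)%E.
Proof.
set m := fine (mu A).
have [m0|m0] := eqVneq m 0.
  by rewrite m0 mul0r; apply: integral_ge0 => x _; rewrite lee_fin sqr_ge0.
have intE : \int[mu]_(x in A) f x = E * m by rewrite /E divfK.
have i1 : mu.-integrable A (EFin \o (fun x => 2 * (E - c) * f x)).
  exact: (integrableZl mA (2 * (E - c)) Lfun2_integrable).
have i2 := integrable_cst_fin (E ^+ 2 - c ^+ 2).
have key : m * (E - c) ^+ 2 <= \int[mu]_(x in A) ((f x - c) ^+ 2).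
  have -> : m * (E - c) ^+ 2 =
      \int[mu]_(x in A) (2 * (E - c) * f x - (cst (E ^+ 2 - c ^+ 2) x)).
    rewrite RintegralB// RintegralZl// ?Rintegral_cst//; last exact: Lfun2_integrable.
    by rewrite intE -/m; ring.
  apply: le_Rintegral => //; last by move=> x _ /=; have := sqr_ge0 (f x - E); nra.
  - exact: (integrableB mA i1 i2).
  - exact: integrable_sqrB.
rewrite -lee_fin in key; apply: le_trans key _.
rewrite /Rintegral fineK//; apply: integrable_fin_num => //.
exact: integrable_sqrB.
Qed.

End finite_set.

Lemma esum_integral_le (I : choiceType) (D : set I) (F : I -> set T) (A : set T)
    (g : T -> \bar R) : countable D -> measurable A ->
  (forall i, D i -> measurable (F i)) -> (forall i, D i -> F i `<=` A) ->
  trivIset D F -> measurable_fun setT g -> (forall x, 0 <= g x)%E ->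
  (\esum_(i in D) \int[mu]_(x in F i) g x <= \int[mu]_(x in A) g x)%E.
Proof.
move=> cD mA mF FA tF mg g0.
under eq_esum do rewrite integral_mkcond.
rewrite -integral_esum//; last 2 first.
- move=> i Di; apply/(measurable_restrictT _ (mF i Di)).1.
  exact: measurable_funS mg.
- by move=> i x _; rewrite /patch; case: ifP.
rewrite [leRHS]integral_mkcond; apply: ge0_integral_mono => x _.
  by apply: esum_ge0 => i _; rewrite /patch; case: ifP.
have [[i [Di Fix]]|nF] := pselect (exists i, D i /\ F i x).
  rewrite (esum_single Di).
  - by rewrite /patch !mem_set//; exact: FA Fix.
  - by rewrite /patch; case: ifP.
  - move=> j Dj ji; rewrite /patch memNset// => Fjx; apply: ji.
    by apply: tF => //; exists x.
rewrite esum1; first by rewrite /patch; case: ifP.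
by move=> i Di; rewrite /patch memNset// => Fix; apply: nF; exists i.
Qed.

End L2.

(** * Dyadic scales and the kernel of the Sobolev norm *)

Section Scales.
Context {R : realType}.
Implicit Types (a d s l q : R).

Lemma sqr_div_powR a l s : 0 < l ->
  (a / l `^ s) ^+ 2 = l `^ (- (2 * s)) * a ^+ 2.
Proof.
move=> l0; rewrite exprMn mulrC; congr (_ * _).
by rewrite -powRN -powR_mulrn ?powR_ge0// -powRrM; congr (_ `^ _); ring.
Qed.

Lemma dyadic_scale d : 0 < d -> exists k : int, d <= 2 ^ k /\ 2 ^ k < 2 * d.
Proof.
move=> d0; pose u := ln d / ln 2; exists (Num.ceil u).
have l2 : 0 < ln 2 :> R by rewrite ln_gt0// ltr1n.
have dE : d = 2 `^ u.
  by rewrite /powR gt_eqF// /u divfK ?gt_eqF// lnK.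
have [c1 c2] : (u <= (Num.ceil u)%:~R) /\ ((Num.ceil u)%:~R < u + 1 :> R).
  have /andP[+ c2] := ceil_itv u; rewrite intrB ltrBlDr => c1.
  by split.
have e2 t : 2 `^ t = expR (t * ln 2) :> R by rewrite /powR gt_eqF.
have -> : 2 * d = expR ((u + 1) * ln 2).
  by rewrite [(u + 1) * _]mulrDl mul1r expRD lnK ?posrE// -e2 -dE mulrC.
rewrite -powR_intmul// dE !e2 ler_expR ltr_expR; split.
  exact: ler_wpM2r (ltW _) _ _ _.
by rewrite ltr_pM2r.
Qed.

Lemma esum_geometric_le a q : 0 <= a -> 0 <= q -> q < 1 ->
  (\esum_(j in [set: nat]) (a * q ^+ j)%:E <= (a / (1 - q))%:E)%E.
Proof.
move=> a0 q0 q1; have t0 j : (0 <= (a * q ^+ j)%:E)%E.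
  by rewrite lee_fin mulr_ge0// exprn_ge0.
rewrite -nneseries_esumT//; apply: lime_le.
  by apply: is_cvg_nneseries => j _ _; exact: t0.
apply: nearW => N; rewrite sumEFin lee_fin -mulr_sumr ler_wpM2l//.
rewrite -[leRHS]mul1r ler_pdivlMr ?subr_gt0// big_mkord mulrC.
rewrite -[1 - q]opprB mulNr -subrX1 opprB gerBl.
exact: exprn_ge0.
Qed.

End Scales.

Lemma natr_le_exp2 (R : realType) (n : nat) : n%:R <= 2 ^+ n :> R.
Proof. by rewrite -natrX ler_nat ltnW// ltn_expl. Qed.

Lemma sobolev_integrand_ge0 (R : realType) n
    (mu : {measure set (borelRn R n) -> \bar R}) s f (x y : 'rV[R]_n) :
  (0 <= sobolev_integrand mu s f x y)%E.
Proof. by rewrite mule_ge0 ?lee_fin ?sqr_ge0// inve_ge0 measure_ge0. Qed.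

Section Kernel.
Context (R : realType) (n : nat).
Hypothesis n_gt0 : (0 < n)%N.
Variable mu : {measure set (borelRn R n) -> \bar R}.
Variable C : R.
Hypothesis C_ge1 : 1 <= C.
Hypothesis muC : forall Q : cube R n, 0 < side Q ->
  (mu (cube_set (Defs.double Q)) <= C%:E * mu (cube_set Q))%E.
Hypothesis mu_lf : locally_finite_measure mu.
Hypothesis muT : mu setT != 0%E.
Implicit Types (x y z w : 'rV[R]_n) (Q P S : cube R n) (r h : R).

Let C_gt0 : 0 < C. Proof. exact: lt_le_trans C_ge1. Qed.

Definition midball x y : set 'rV[R]_n :=
  eball (2^-1 *: (x + y)) (enorm (x - y) / 2).

Lemma midballC x y : midball x y = midball y x.
Proof. by rewrite /midball addrC enormB. Qed.

Lemma measurable_midball x y : measurable (midball x y : set (borelRn R n)).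
Proof. exact: measurable_eball. Qed.

Definition mass Q : R := fine (mu (cube_set Q)).

Lemma massE Q : mu (cube_set Q) = (mass Q)%:E.
Proof. by rewrite fineK// ge0_fin_numE// (mu_cube_fin C_ge1 muC mu_lf). Qed.

Lemma mass_ge0 Q : 0 <= mass Q.
Proof. exact: fine_ge0. Qed.

Lemma mass_gt0 Q : 0 < side Q -> 0 < mass Q.
Proof. by move=> Q0; rewrite -lte_fin -massE (mu_cube_gt0 C_ge1 muC muT). Qed.

(** A ball whose diameter joins two points of [Q] lies in the dilate of [Q] by
the factor [n + 1], and [n + 1 <= 2 ^ (n + 1)]. *)
Lemma mu_midball_le Q x y : 0 < side Q -> cube_set Q x -> cube_set Q y ->
  (mu (midball x y) <= (C ^+ n.+1)%:E * mu (cube_set Q))%E.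
Proof.
move=> Q0 Qx Qy; have Q20 : 0 < side Q / 2 by rewrite divr_gt0.
have := @doubling_compare _ _ mu C C_ge1 muC (center Q) _ n.+1
  (midball x y) (cube_set Q) Q20; apply.
- exact: measurable_midball.
- exact: measurable_cube_set.
- move=> w wB; apply/mem_ccube => i.
  have wi := coord_le_enorm (w - 2^-1 *: (x + y)) i.
  have {wB}wi := le_lt_trans wi wB.
  have /enorm_le : forall j, `|(x - y) ord0 j| <= side Q.
    by move=> j; rewrite !mxE ltW// (cube_dist j Qx Qy).
  move=> /(_ (ltW Q0)) xy.
  have := cube_near_center i Q0 Qx; have := cube_near_center i Q0 Qy.
  have : (n%:R + 1) * side Q <= 2 ^+ n.+1 * side Q.
    by rewrite ler_pM2r// natr1 natr_le_exp2.
  move: wi; rewrite !mxE ltr_norml !ler_norml.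
  move: (center Q ord0 i) => c.
  by move=> /andP[a b] e /andP[a' b'] /andP[a2 b2]; apply/andP; split; lra.
- by rewrite ccube_center.
Qed.

(** The ball contains the cube with the same center and half-side
[side P / (4 * n)], while [P] lies in the cube with the same center and
half-side [2 * side P]. *)
Lemma mu_midball_ge P x y : enorm (x - y) <= side P ->
  side P < 2 * enorm (x - y) -> cube_set P x ->
  (mu (cube_set P) <= (C ^+ (n + 3))%:E * mu (midball x y))%E.
Proof.
move=> dP Pd Px.
have P0 : 0 < side P by have := enorm_ge0 (x - y); lra.
have nR : (0 : R) < n%:R by rewrite ltr0n.
have r0 : 0 < side P / (4 * n%:R) by rewrite divr_gt0// mulr_gt0.
have := @doubling_compare _ _ mu C C_ge1 muC (2^-1 *: (x + y)) _ (n + 3)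
  (cube_set P) (midball x y) r0; apply.
- exact: measurable_cube_set.
- exact: measurable_midball.
- move=> w Pw; apply/mem_ccube => i.
  have := cube_dist i Pw Px; have := coord_le_enorm (x - y) i.
  have : 2 * side P <= 2 ^+ (n + 3) * (side P / (4 * n%:R)).
    rewrite mulrA ler_pdivlMr ?mulr_gt0// exprD.
    have -> : 2 * side P * (4 * n%:R) = n%:R * 2 ^+ 3 * side P by ring.
    by rewrite !ler_wpM2r ?(ltW P0)// natr_le_exp2.
  rewrite !mxE ler_norml ltr_norml.
  by move=> e /andP[a b] /andP[a' b']; apply/andP; split; lra.
- move=> w /mem_ccube wz; rewrite /midball /eball /=.
  apply: (@le_lt_trans _ _ (n%:R * (side P / (4 * n%:R)))); last first.
    have -> : n%:R * (side P / (4 * n%:R)) = side P / 4.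
      by field; rewrite gt_eqF.
    by lra.
  apply: enorm_le; first exact: ltW.
  move=> i; have := wz i; rewrite !mxE ler_norml => /andP[a b].
  by apply/andP; split; lra.
Qed.

Lemma mu_midball_bounds x y : x != y -> exists2 b : R, 0 < b &
  mu (midball x y) = b%:E.
Proof.
rewrite -subr_eq0 => /enorm_gt0 d0.
pose P : cube R n := (x, enorm (x - y)).
have P0 : 0 < side P by [].
have := @mu_midball_ge P x y (lexx _) _ (corner_mem P0).
have : side P < 2 * enorm (x - y) by rewrite /side /=; lra.
move=> /[swap] /[apply]; rewrite massE => lo.
have : (mu (midball x y) < +oo)%E.
  have [r r0 Br] : exists2 r, 0 < r &
      midball x y `<=` cube_set (ccube (2^-1 *: (x + y)) r).
    exists (enorm (x - y)) => // w wB; apply/mem_ccube => i.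
    have := le_lt_trans (coord_le_enorm (w - 2^-1 *: (x + y)) i) wB.
    by rewrite !mxE ltr_norml => /andP[a b]; apply/andP; split; lra.
  apply: le_lt_trans (mu_cube_fin C_ge1 muC mu_lf (ccube (2^-1 *: (x + y)) r)).
  apply: le_measure; rewrite ?inE//; first exact: measurable_midball.
  exact: measurable_cube_set.
move=> hi; exists (fine (mu (midball x y))); last by rewrite fineK// ge0_fin_numE.
rewrite fine_gt0// hi andbT lt_neqAle measure_ge0 andbT eq_sym.
apply/eqP => B0; move: lo; rewrite B0 mule0 lee_fin leNgt.
by rewrite mass_gt0.
Qed.

Lemma sobolev_integrandE s f x y (b : R) : x != y -> 0 < b ->
  mu (midball x y) = b%:E -> sobolev_integrand mu s f x y =
  (enorm (x - y) `^ (- (2 * s)) * (f x - f y) ^+ 2 / b)%:E.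
Proof.
rewrite -subr_eq0 => /enorm_gt0 d0 b0 mB.
rewrite /sobolev_integrand -/(midball x y) mB inver gt_eqF// -EFinM.
by rewrite sqr_div_powR.
Qed.

End Kernel.

(** * The dyadic norm is dominated by the Sobolev norm *)

Lemma powR_exprn (R : realType) (a p : R) j : 0 <= a ->
  (a ^+ j) `^ p = (a `^ p) ^+ j.
Proof.
by move=> a0; rewrite -!powR_mulrn ?powR_ge0// -!powRrM mulrC.
Qed.

Lemma powR2N_lt1 (R : realType) (p : R) : 0 < p -> 2 `^ (- p) < 1.
Proof.
move=> p0; rewrite /powR gt_eqF// -[ltRHS]expR0 ltr_expR mulNr oppr_lt0.
by rewrite mulr_gt0// ln_gt0// ltr1n.
Qed.

Lemma integral_mul_indic d (T : measurableType d) (R : realType)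
    (mu : {measure set T -> \bar R}) (A : set T) (g : T -> \bar R) :
  (\int[mu]_x (g x * (\1_A x)%:E) = \int[mu]_(x in A) g x)%E.
Proof.
rewrite [RHS]integral_mkcond; apply: eq_integral => x _.
by rewrite /patch indicE; case: ifP; rewrite ?mule1// mule0.
Qed.

Section Comparison.
Context (R : realType) (n : nat).
Hypothesis n_gt0 : (0 < n)%N.
Variable mu : {measure set (borelRn R n) -> \bar R}.
Variable C : R.
Hypothesis C_ge1 : 1 <= C.
Hypothesis muC : forall Q : cube R n, 0 < side Q ->
  (mu (cube_set (Defs.double Q)) <= C%:E * mu (cube_set Q))%E.
Hypothesis mu_lf : locally_finite_measure mu.
Hypothesis muT : mu setT != 0%E.
Variable D : set (cube R n).
Hypothesis gD : dyadic_grid D.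
Variable s : R.
Hypothesis s_gt0 : 0 < s.
Implicit Types (x y z w : 'rV[R]_n) (Q P S : cube R n) (r h : R).

Let C_gt0 : 0 < C. Proof. exact: lt_le_trans C_ge1. Qed.

Definition weight Q : R := side Q `^ (- (2 * s)).

Lemma weight_ge0 Q : 0 <= weight Q. Proof. exact: powR_ge0. Qed.

Let q : R := 2 `^ (- (2 * s)).
Let q_ge0 : 0 <= q. Proof. exact: powR_ge0. Qed.
Let q_lt1 : q < 1. Proof. by apply: powR2N_lt1; rewrite mulr_gt0. Qed.

Lemma weight_scale j Q P : 0 <= side Q -> side P = 2 ^+ j * side Q ->
  weight P = weight Q * q ^+ j.
Proof.
by move=> Q0 sP; rewrite /weight sP powRM ?exprn_ge0// powR_exprn// mulrC.
Qed.

Definition kernel_const : R := (2 ^+ n) `^ (2 * s) / (1 - q).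

Lemma kernel_const_gt0 : 0 < kernel_const.
Proof. by rewrite divr_gt0 ?subr_gt0// powR_gt0// exprn_gt0. Qed.

(** The cubes containing both [x] and [y] have side at least [2 ^ (k - n)], where
[2 ^ k] is comparable to [enorm (x - y)]. Those containing [x] are thus among
the ancestors of a single cube of that side, and their weights form a geometric
progression. *)
Lemma kernel_sum_le x y : x != y ->
  (\esum_(Q in [set Q | [/\ D Q, cube_set Q x & cube_set Q y]]) (weight Q)%:E
    <= (kernel_const * enorm (x - y) `^ (- (2 * s)))%:E)%E.
Proof.
rewrite -subr_eq0 => /enorm_gt0 d0; set d := enorm (x - y) in d0 *.
have [k [dk kd]] := dyadic_scale d0.
have [Q0 [DQ0 sQ0 Q0x]] := grid_cell gD (k - n%:Z) x.
have Q00 := grid_side_gt0 gD DQ0.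
have sQ0' : side Q0 = 2 ^ k / 2 ^+ n.
  by rewrite sQ0 expfzDr// exprnN.
set G := [set Q | _].
have Ganc : G `<=` (fun j => ancestor D j Q0) @` [set: nat].
  move=> Q [DQ Qx Qy]; have [lev _ _] := gD; have [l sQ] := lev Q DQ.
  have Qpos := grid_side_gt0 gD DQ.
  have dQ : d <= n%:R * side Q.
    apply: enorm_le; first exact: ltW.
    by move=> i; rewrite !mxE ltW// (cube_dist i Qx Qy).
  have lk : (k - n%:Z <= l).
    have two1 : (1 : R) < 2 by rewrite ltr1n.
    rewrite -ltzD1 -(ltr_eXz2l two1) -sQ0 sQ0' ltr_pdivrMr ?exprn_gt0//.
    apply: (lt_le_trans kd); rewrite expfzDr// expr1z -sQ.
    have -> : side Q * 2 * 2 ^+ n = 2 * (2 ^+ n * side Q) by ring.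
    rewrite ler_pM2l//; apply: (le_trans dQ).
    by rewrite ler_pM2r// natr_le_exp2.
  have [j jE] : exists j : nat, l = (k - n%:Z) + j%:Z.
    by exists (absz (l - (k - n%:Z))%R); rewrite gez0_abs ?subr_ge0// addrC subrK.
  exists j => //; rewrite -(ancestor_eq n_gt0 gD DQ0 DQ _ Q0x Qx)//.
  by rewrite sQ sQ0 jE expfzDr// mulrC.
apply: le_trans (le_esum_subset _ Ganc) _.
rewrite esum_image; last first.
  move=> i j _ _ ij; have [_ si _] := ancestorP n_gt0 gD i DQ0.
  have [_ sj _] := ancestorP n_gt0 gD j DQ0.
  have : (2 : R) ^+ i = 2 ^+ j.
    by apply: (mulIf (lt0r_neq0 Q00)); rewrite -si -sj ij.
  by apply: ieexprIn => //; rewrite gt_eqF// ltr1n.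
apply: (@le_trans _ _ (\esum_(j in [set: nat]) (weight Q0 * q ^+ j)%:E)%E).
  apply: le_esum => j _; have [_ sj _] := ancestorP n_gt0 gD j DQ0.
  by rewrite (weight_scale (ltW Q00) sj).
apply: le_trans (esum_geometric_le (weight_ge0 Q0) q_ge0 q_lt1) _.
rewrite lee_fin /kernel_const mulrAC ler_pM2r ?invr_gt0 ?subr_gt0//.
rewrite /weight sQ0' powRM ?exprz_ge0 ?invr_ge0 ?exprn_ge0// mulrC.
rewrite -powR_inv1 ?exprn_ge0// -powRrM mulN1r opprK.
rewrite ler_pM2l ?powR_gt0 ?exprn_gt0// !powRN.
rewrite lef_pV2 ?posrE ?powR_gt0 ?exprz_gt0//.
by rewrite ge0_ler_powR ?nnegrE ?mulr_ge0 ?(ltW s_gt0) ?(ltW d0) ?exprz_ge0.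
Qed.

Variable f : borelRn R n -> R.
Hypothesis f2 : f \in Lfun mu 2%:E.
Let mf : measurable_fun setT f. Proof. exact: Lfun_measurable f2. Qed.

Local Notation avg Q := (average mu Q f).
Local Notation mass Q := (mass mu Q).

Definition energy Q : \bar R :=
  (\int[mu]_(x in cube_set Q) ((f x - avg Q) ^+ 2)%:E)%E.

Lemma dyadic_sqnormE : dyadic_sobolev_sqnorm mu D s f =
  (\esum_(Q in D) ((weight Q)%:E * energy Q))%E.
Proof.
apply: eq_esum => Q DQ; rewrite /energy -ge0_integralZl//; last 4 first.
- exact: measurable_cube_set.
- exact: measurable_sqrB f2 _ _.
- by move=> x _; rewrite lee_fin sqr_ge0.
- by rewrite lee_fin weight_ge0.
apply: eq_integral => x _; rewrite -EFinM real_normK ?num_real//.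
by rewrite sqr_div_powR// (grid_side_gt0 gD).
Qed.

Definition pair_term Q x y : \bar R :=
  ((weight Q / mass Q * (f x - f y) ^+ 2 * \1_(cube_set Q) y)%:E *
   (\1_(cube_set Q) x)%:E)%E.

Lemma pair_term_ge0 Q x y : (0 <= pair_term Q x y)%E.
Proof.
rewrite /pair_term -EFinM lee_fin; have := sqr_ge0 (f x - f y).
move: (_ ^+ 2) => a a0.
by rewrite !mulr_ge0// ?weight_ge0// invr_ge0 mass_ge0.
Qed.

Lemma pair_sum_le x y : (\esum_(Q in D) pair_term Q x y <=
  (C ^+ n.+1 * kernel_const)%:E * sobolev_integrand mu s f x y)%E.
Proof.
have K0 := ltW kernel_const_gt0.
have [->|xy] := eqVneq x y.
  rewrite esum1.
    rewrite mule_ge0 ?sobolev_integrand_ge0// lee_fin.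
    by rewrite mulr_ge0 ?exprn_ge0 ?(ltW C_gt0).
  by move=> Q _; rewrite /pair_term subrr expr0n /= mulr0 mul0r mul0e.
have [b b0 mB] := mu_midball_bounds n_gt0 C_ge1 muC mu_lf muT xy.
rewrite (sobolev_integrandE s f xy b0 mB).
(* [a] bounds all factors but the weight, uniformly in the cube *)
pose a := (f x - f y) ^+ 2 * C ^+ n.+1 / b.
have a0 : 0 <= a.
  by rewrite divr_ge0 ?(ltW b0)// mulr_ge0 ?sqr_ge0 ?exprn_ge0 ?(ltW C_gt0).
pose G := [set Q | [/\ D Q, cube_set Q x & cube_set Q y]].
apply: (@le_trans _ _ (\esum_(Q in G) (a%:E * (weight Q)%:E))%E).
  rewrite esum_mkcond [leRHS]esum_mkcond; apply: le_esum => Q _.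
  case: ifPn => [/set_mem DQ|_]; last first.
    by case: ifP => // _; rewrite -EFinM lee_fin mulr_ge0 ?weight_ge0.
  case: ifPn => [/set_mem [_ Qx Qy]|nG].
    rewrite /pair_term !indicE !mem_set// mulr1 mule1 -EFinM lee_fin.
    have Q0 := grid_side_gt0 gD DQ.
    have := mu_midball_le C_ge1 muC Q0 Qx Qy.
    rewrite mB (massE C_ge1 muC mu_lf) -EFinM lee_fin => bm.
    have m0 := mass_gt0 C_ge1 muC mu_lf muT Q0.
    have -> : a * weight Q = (f x - f y) ^+ 2 * weight Q * (C ^+ n.+1 / b).
      by rewrite /a; ring.
    have -> : weight Q / mass Q * (f x - f y) ^+ 2 =
      (f x - f y) ^+ 2 * weight Q * (mass Q)^-1 by ring.
    rewrite ler_wpM2l//.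
      by apply: mulr_ge0; [exact: sqr_ge0|exact: weight_ge0].
    by rewrite ler_pdivlMr// mulrC ler_pdivrMr.
  rewrite /pair_term !indicE.
  have [Qx|nQx] := pselect (cube_set Q x); last by rewrite (memNset nQx) mule0.
  have [Qy|nQy] := pselect (cube_set Q y).
    by move: nG; rewrite notin_setE; case.
  by rewrite (memNset nQy) mulr0 mul0e.
rewrite esumZl//; last by move=> Q _; rewrite lee_fin weight_ge0.
apply: (@le_trans _ _ (a%:E * (kernel_const * enorm (x - y) `^ (- (2 * s)))%:E)%E).
  by rewrite lee_wpmul2l// kernel_sum_le.
by rewrite -!EFinM lee_fin /a le_eqVlt; apply/orP; left; apply/eqP; ring.
Qed.

(** The sum over the cubes is exchanged with the integral in [y] of explicit
functions of one variable, and [pair_sum_le] is applied for each fixed [y]; the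
constant is kept on the dyadic side, where every function is measurable. *)
Lemma dyadic_le_sobolev :
  (((C ^+ n.+1 * kernel_const)^-1)%:E * dyadic_sobolev_sqnorm mu D s f <=
   sobolev_sqnorm mu s f)%E.
Proof.
set K := C ^+ n.+1 * kernel_const.
have K0 : 0 < K by rewrite mulr_gt0 ?exprn_gt0 ?kernel_const_gt0.
have Kinv : (0 <= (K^-1)%:E)%E by rewrite lee_fin invr_ge0 ltW.
have cD := grid_countable gD.
pose h Q (y : borelRn R n) : \bar R := ((weight Q)%:E *
  (((f y - avg Q) ^+ 2)%:E * (\1_(cube_set Q) y)%:E))%E.
have h0 Q y : (0 <= h Q y)%E.
  rewrite /h -!EFinM lee_fin; have := sqr_ge0 (f y - avg Q).
  by move: (_ ^+ 2) => a a0; rewrite !mulr_ge0// ?weight_ge0.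
have mh0 Q : measurable_fun setT (fun y : borelRn R n =>
    ((f y - avg Q) ^+ 2)%:E * (\1_(cube_set Q) y)%:E)%E.
  apply: emeasurable_funM; first exact: measurable_sqrB f2 _ _.
  by apply/measurable_EFinP; apply: measurable_indic; exact: measurable_cube_set.
have mh Q : measurable_fun setT (h Q) by apply: measurable_funeM; exact: mh0.
have -> : dyadic_sobolev_sqnorm mu D s f = (\int[mu]_y \esum_(Q in D) h Q y)%E.
  rewrite dyadic_sqnormE integral_esum//; apply: eq_esum => Q DQ.
  rewrite /h ge0_integralZl// ?lee_fin ?weight_ge0//.
    by rewrite integral_mul_indic.
  by move=> y _; rewrite -EFinM lee_fin mulr_ge0 ?sqr_ge0.
rewrite -ge0_integralZl//; last 2 first.
- by apply: measurable_esum.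
- by move=> y _; exact: esum_ge0.
apply: ge0_integral_mono => y _; first by rewrite mule_ge0// esum_ge0.
have mG Q : measurable_fun setT (fun x : borelRn R n => pair_term Q x y).
  apply: emeasurable_funM; apply/measurable_EFinP; last first.
    by apply: measurable_indic; exact: measurable_cube_set.
  apply: measurable_funM => //; apply: measurable_funM => //.
  by apply/measurable_funX/measurable_funB.
have hG Q : D Q -> (h Q y <= \int[mu]_x pair_term Q x y)%E.
  move=> DQ; have [Qy|nQy] := pselect (cube_set Q y); last first.
    rewrite /h indicE memNset// !mule0; apply: integral_ge0 => x _.
    exact: pair_term_ge0.
  have m0 := mass_gt0 C_ge1 muC mu_lf muT (grid_side_gt0 gD DQ).
  rewrite integral_mul_indic /h indicE mem_set// mule1.
  under eq_integral do rewrite mulr1 EFinM.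
  rewrite ge0_integralZl//; last 4 first.
  - exact: measurable_cube_set.
  - exact: measurable_sqrB f2 _ _.
  - by move=> x _; rewrite lee_fin sqr_ge0.
  - by rewrite lee_fin divr_ge0 ?weight_ge0 ?mass_ge0.
  have := jensen_sqr f2 (measurable_cube_set Q) (mu_cube_fin C_ge1 muC mu_lf Q) (f y).
  rewrite -/(mass Q) -/(avg Q) => J.
  apply: le_trans (lee_wpmul2l _ J); last first.
    by rewrite lee_fin divr_ge0 ?weight_ge0 ?mass_ge0.
  rewrite -!EFinM lee_fin le_eqVlt; apply/orP; left; apply/eqP.
  by field; rewrite gt_eqF.
apply: (@le_trans _ _ ((K^-1)%:E * \esum_(Q in D) \int[mu]_x pair_term Q x y)%E).
  by rewrite lee_wpmul2l// le_esum.
rewrite -integral_esum//; last by move=> Q x _; exact: pair_term_ge0.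
have G0 x : (0 <= \esum_(Q in D) pair_term Q x y)%E.
  by apply: esum_ge0 => Q _; exact: pair_term_ge0.
rewrite -ge0_integralZl//; last first.
  by apply: measurable_esum => // Q x _; exact: pair_term_ge0.
apply: ge0_integral_mono => x _; first by rewrite mule_ge0.
by rewrite lee_pdivrMl// pair_sum_le.
Qed.

End Comparison.

(** * The Sobolev norm is dominated by the dyadic norm *)

(** Induction on [N] with [(u + v) ^ 2 <= t / (t - 1) * u ^ 2 + t * v ^ 2]. *)
Lemma weighted_sqr_sum_le (R : realFieldType) (t : R) (u : nat -> R) N : 1 < t ->
  (\sum_(j < N) u j) ^+ 2 <= t / (t - 1) * \sum_(j < N) t ^+ j * u j ^+ 2.
Proof.
move=> t1; have t0 : 0 < t - 1 by lra.
elim: N u => [|N IH] u; first by rewrite !big_ord0 expr0n mulr0.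
rewrite !big_ord_recl expr0 mul1r.
have := IH (fun j => u j.+1).
have -> : \sum_(i < N) t ^+ bump 0 i * u (bump 0 i) ^+ 2 =
    t * \sum_(i < N) t ^+ i * u i.+1 ^+ 2.
  by rewrite mulr_sumr; apply: eq_bigr => i _; rewrite /bump /= add1n exprS mulrA.
have -> : \sum_(i < N) u (bump 0 i) = \sum_(i < N) u i.+1 by [].
set S := \sum_(i < N) u i.+1; set V := \sum_(i < N) _ => SV.
have V2 : t * S ^+ 2 <= t / (t - 1) * (t * V).
  have -> : t / (t - 1) * (t * V) = t * (t / (t - 1) * V) by ring.
  by rewrite ler_pM2l//; lra.
rewrite (_ : u (ord0 : 'I_N.+1) = u 0%N)//.
rewrite mulrDr.
apply: le_trans (_ : t / (t - 1) * u 0%N ^+ 2 + t * S ^+ 2 <= _); last first.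
  by rewrite lerD2l.
rewrite -subr_ge0.
have -> : t / (t - 1) * u 0%N ^+ 2 + t * S ^+ 2 - (u 0%N + S) ^+ 2 =
  (t - 1)^-1 * (u 0%N - (t - 1) * S) ^+ 2.
  by field; rewrite gt_eqF.
by rewrite mulr_ge0 ?sqr_ge0// invr_ge0 ltW.
Qed.

Lemma telescope_sqr_le (R : realFieldType) (t : R) (a b e e' : nat -> R) N :
  1 < t ->
  (forall j, `|(a j - a j.+1) - (b j - b j.+1)| <= e j + e' j) ->
  (a 0%N - b 0%N) ^+ 2 <= 2 * (a N - b N) ^+ 2 +
     \sum_(j < N) (4 * (t / (t - 1)) * t ^+ j * e j ^+ 2 +
                   4 * (t / (t - 1)) * t ^+ j * e' j ^+ 2).
Proof.
move=> t1 ab; set K := t / (t - 1).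
have K0 : 0 < K by rewrite divr_gt0//; lra.
have tele : a 0%N - b 0%N =
    (a N - b N) + \sum_(j < N) ((a j - a j.+1) - (b j - b j.+1)).
  elim: N {ab K0} => [|N IH]; first by rewrite big_ord0 addr0.
  by rewrite big_ord_recr /= IH; ring.
set S := \sum_(j < N) _ in tele.
have S2 : S ^+ 2 <= K * \sum_(j < N) t ^+ j * (e j + e' j) ^+ 2.
  apply: le_trans (_ : (\sum_(j < N) (e j + e' j)) ^+ 2 <= _); last first.
    exact: (weighted_sqr_sum_le (fun j => e j + e' j)).
  rewrite -(real_normK (num_real S)) lerXn2r ?nnegrE//.
    by apply: sumr_ge0 => j _; exact: le_trans (ab j).
  apply: le_trans (ler_norm_sum _ _ _) _.
  by apply: ler_sum => j _.
rewrite tele; apply: le_trans (_ : 2 * (a N - b N) ^+ 2 + 2 * S ^+ 2 <= _).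
  by have := sqr_ge0 (a N - b N - S); nra.
rewrite lerD2l.
apply: le_trans (_ : 2 * (K * \sum_(j < N) t ^+ j * (e j + e' j) ^+ 2) <= _).
  by rewrite ler_pM2l.
rewrite !mulr_sumr; apply: ler_sum => j _.
have tj : 0 <= K * t ^+ j by rewrite mulr_ge0 ?exprn_ge0 ?(ltW K0)//; lra.
have -> : 2 * (K * (t ^+ j * (e j + e' j) ^+ 2)) =
  K * t ^+ j * (2 * (e j + e' j) ^+ 2) by ring.
have -> : 4 * K * t ^+ j * e j ^+ 2 + 4 * K * t ^+ j * e' j ^+ 2 =
  K * t ^+ j * (4 * (e j ^+ 2 + e' j ^+ 2)) by ring.
by rewrite ler_wpM2l//; have := sqr_ge0 (e j - e' j); nra.
Qed.

Section EsumProd.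
Context d (T : measurableType d) (R : realType).
Variables (mu : {measure set T -> \bar R}) (I : choiceType) (D : set I).
Variables (A G : I -> T -> \bar R).
Hypothesis cD : countable D.
Hypothesis mA : forall i, measurable_fun setT (A i).
Hypothesis mG : forall i, measurable_fun setT (G i).
Hypothesis A0 : forall i x, (0 <= A i x)%E.
Hypothesis G0 : forall i x, (0 <= G i x)%E.

Let AG0 i x y : (0 <= A i y * G i x)%E. Proof. exact: mule_ge0. Qed.

Let iG0 i : (0 <= \int[mu]_x G i x)%E. Proof. exact: integral_ge0. Qed.

Lemma integral_esum_prod1 y : (\int[mu]_x (\esum_(i in D) (A i y * G i x)) =
  \esum_(i in D) (A i y * \int[mu]_x G i x))%E.
Proof.
rewrite integral_esum//; last by move=> i Di; exact: measurable_funeM.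
by apply: eq_esum => i Di; rewrite ge0_integralZl.
Qed.

Lemma measurable_esum_prod1 :
  measurable_fun setT (fun y => \int[mu]_x (\esum_(i in D) (A i y * G i x)))%E.
Proof.
under eq_fun do rewrite integral_esum_prod1.
apply: measurable_esum => //.
- by move=> i Di; exact: emeasurable_funM.
- by move=> i x Di; exact: mule_ge0.
Qed.

Lemma integral_esum_prod :
  (\int[mu]_y \int[mu]_x (\esum_(i in D) (A i y * G i x)) =
   \esum_(i in D) (\int[mu]_y A i y * \int[mu]_x G i x))%E.
Proof.
under eq_integral do rewrite integral_esum_prod1.
rewrite integral_esum//.
- by apply: eq_esum => i Di; rewrite ge0_integralZr.
- by move=> i Di; apply: emeasurable_funM.
- by move=> i x Di; exact: mule_ge0.
Qed.

End EsumProd.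

Section Upper.
Context (R : realType) (n : nat).
Hypothesis n_gt0 : (0 < n)%N.
Variable mu : {measure set (borelRn R n) -> \bar R}.
Variable C : R.
Hypothesis C_ge1 : 1 <= C.
Hypothesis muC : forall Q : cube R n, 0 < side Q ->
  (mu (cube_set (Defs.double Q)) <= C%:E * mu (cube_set Q))%E.
Hypothesis mu_lf : locally_finite_measure mu.
Hypothesis muT : mu setT != 0%E.
Variable D : set (cube R n).
Hypothesis gD : dyadic_grid D.
Variable s : R.
Hypothesis s_gt0 : 0 < s.
Implicit Types (x y z w : 'rV[R]_n) (Q P S : cube R n) (r h : R).

Let C_gt0 : 0 < C. Proof. exact: lt_le_trans C_ge1. Qed.

Let q : R := 2 `^ (- (2 * s)).
Let q_gt0 : 0 < q. Proof. exact: powR_gt0. Qed.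

Variable f : borelRn R n -> R.
Hypothesis f2 : f \in Lfun mu 2%:E.
Let mf : measurable_fun setT f. Proof. exact: Lfun_measurable f2. Qed.

Local Notation avg Q := (average mu Q f).
Local Notation mass Q := (mass mu Q).
Local Notation weight := (weight s).
Local Notation energy Q := (energy mu f Q).

Let muE Q : mu (cube_set Q) = (mass Q)%:E := massE C_ge1 muC mu_lf Q.
Let mass0 Q : D Q -> 0 < mass Q.
Proof.
by move=> DQ; exact: (mass_gt0 C_ge1 muC mu_lf muT (grid_side_gt0 gD DQ)).
Qed.

Definition jump Q : R := (avg Q - avg (parent D Q)) ^+ 2.

Lemma jump_ge0 Q : 0 <= jump Q. Proof. exact: sqr_ge0. Qed.

Lemma avg_sqr_le Q :
  mass Q * avg Q ^+ 2 <= fine (\int[mu]_x ((f x) ^+ 2)%:E)%E.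
Proof.
have i2 := Lfun2_integrable_sqr f2.
have fin := integrable_fin_num measurableT i2.
rewrite -lee_fin fineK//.
have := jensen_sqr f2 (measurable_cube_set Q) (mu_cube_fin C_ge1 muC mu_lf Q) 0.
rewrite subr0 => /le_trans; apply.
under eq_integral do rewrite subr0.
apply: ge0_subset_integral => //; first exact: measurable_cube_set.
- exact: measurable_int i2.
- by move=> x _; rewrite lee_fin sqr_ge0.
Qed.

(** By Jensen's inequality the squared average over [Q] is at most the squared
norm of [f] divided by the measure of [Q], which tends to infinity along the
ancestors. *)
Lemma avg_ancestor_small P (e : R) : D P -> 0 < e ->
  exists N, forall M, (N <= M)%N -> avg (ancestor D M P) ^+ 2 <= e.
Proof.
move=> DP e0; set F := fine (\int[mu]_x ((f x) ^+ 2)%:E)%E.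
have F0 : 0 <= F.
  by apply: fine_ge0; apply: integral_ge0 => x _; rewrite lee_fin sqr_ge0.
have [N BN] := mu_ancestor_growth C_ge1 muC mu_lf n_gt0 gD ((F + 1) / e) muT DP.
exists N => M /BN; rewrite muE lee_fin ler_pdivrMr// => B.
have [DA _ _] := ancestorP n_gt0 gD M DP.
have m0 := mass0 DA.
have := avg_sqr_le (ancestor D M P); rewrite -/F => mF.
by rewrite -(ler_pM2l m0); lra.
Qed.

Variable t : R.
Hypothesis t_gt1 : 1 < t.

Let t_ge0 : 0 <= t. Proof. exact: ltW (lt_trans ltr01 t_gt1). Qed.

Let K : R := 4 * (t / (t - 1)).
Let K_ge0 : 0 <= K.
Proof. by rewrite mulr_ge0// divr_ge0// subr_ge0 ltW. Qed.

Definition tail_term P j (x : borelRn R n) : \bar R :=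
  ((K * t ^+ j * jump (ancestor D j P))%:E *
   (\1_(halo (ancestor D j P) (side P)) x)%:E)%E.

Lemma tail_term_ge0 P j x : (0 <= tail_term P j x)%E.
Proof.
rewrite /tail_term -EFinM lee_fin; have := jump_ge0 (ancestor D j P).
move: (jump _) => a a0; have tj : 0 <= t ^+ j by exact: exprn_ge0.
by rewrite mulr_ge0// mulr_ge0// mulr_ge0.
Qed.

Lemma measurable_tail_term P j : measurable_fun setT (tail_term P j).
Proof.
apply: measurable_funeM; apply/measurable_EFinP; apply: measurable_indic.
exact: measurable_halo.
Qed.

(** A bound, seen from a point [x] of [P], for the contribution of the ancestors
of [P] to the difference between the averages over [P] and over a nearby cube
of the same generation: the jump of order [j] only counts if [x] is close to
the boundary of the corresponding ancestor. *)
Definition tail P (x : borelRn R n) : \bar R :=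
  \esum_(j in [set: nat]) tail_term P j x.

Lemma tail_ge0 P x : (0 <= tail P x)%E.
Proof. by apply: esum_ge0 => j _; exact: tail_term_ge0. Qed.

Lemma measurable_tail P : measurable_fun setT (tail P).
Proof.
apply: measurable_esum => //; first exact: countableP.
- by move=> j _; exact: measurable_tail_term.
- by move=> j x _; exact: tail_term_ge0.
Qed.

(** If [y] belonged to the ancestor of [P], that ancestor would be the one
of [P'] as well. *)
Lemma ancestor_halo P P' x y j : D P -> D P' -> side P = side P' ->
  cube_set P x -> cube_set P' y ->
  (forall i, `|x ord0 i - y ord0 i| <= side P) ->
  ancestor D j P <> ancestor D j P' -> halo (ancestor D j P) (side P) x.
Proof.
move=> DP DP' PP' Px P'y xy neq.
have [DA sA PA] := ancestorP n_gt0 gD j DP.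
have [DA' sA' PA'] := ancestorP n_gt0 gD j DP'.
apply/haloP; first exact: ltW (grid_side_gt0 gD DP).
split; first exact: PA.
exists y => // Ay; apply: neq; apply: (grid_level_inj gD DA DA' _ Ay).
  by rewrite sA sA' PP'.
exact: PA'.
Qed.

(** The telescoping terms of order [j] cancel once the ancestors of order [j]
coincide, and otherwise [x] and [y] belong to boundary layers; the remainders
after [N] steps tend to zero by [avg_ancestor_small]. *)
Lemma avg_diff_le P P' x y : D P -> D P' -> side P = side P' ->
  cube_set P x -> cube_set P' y ->
  (forall i, `|x ord0 i - y ord0 i| <= side P) ->
  (((avg P - avg P') ^+ 2)%:E <= tail P x + tail P' y)%E.
Proof.
move=> DP DP' PP' Px P'y xy.
pose a j := avg (ancestor D j P); pose b j := avg (ancestor D j P').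
pose e j := `|a j - a j.+1| * \1_(halo (ancestor D j P) (side P)) x.
pose e' j := `|b j - b j.+1| * \1_(halo (ancestor D j P') (side P')) y.
have step j : `|(a j - a j.+1) - (b j - b j.+1)| <= e j + e' j.
  have [same|neq] := pselect (ancestor D j P = ancestor D j P').
    have -> : a j - a j.+1 - (b j - b j.+1) = 0.
      by rewrite /a /b /ancestor !iterS -!/(ancestor _ _ _) same; ring.
    by rewrite normr0 /e /e' addr_ge0// mulr_ge0.
  have hx := ancestor_halo DP DP' PP' Px P'y xy neq.
  have hy : halo (ancestor D j P') (side P') y.
    apply: (ancestor_halo DP' DP (esym PP') P'y Px) => [i|/esym//].
    by rewrite distrC -PP'.
  by rewrite /e /e' !indicE !mem_set// !mulr1 ler_normB.
have eE j : (K * t ^+ j * e j ^+ 2)%:E = tail_term P j x.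
  rewrite /tail_term -EFinM; congr EFin; rewrite /e exprMn real_normK ?num_real//.
  by rewrite -[jump _]/((a j - a j.+1) ^+ 2) indicE; case: (_ \in _) => /=; ring.
have e'E j : (K * t ^+ j * e' j ^+ 2)%:E = tail_term P' j y.
  rewrite /tail_term -EFinM; congr EFin; rewrite /e' exprMn real_normK ?num_real//.
  by rewrite -[jump _]/((b j - b j.+1) ^+ 2) indicE; case: (_ \in _) => /=; ring.
apply/lee_addgt0Pr => eps eps0.
(* [2 * (u - v) ^ 2 <= 4 * (u ^ 2 + v ^ 2)] explains the factor 8 *)
have e80 : 0 < eps / 8 by rewrite divr_gt0.
have [N1 hN1] := avg_ancestor_small DP e80.
have [N2 hN2] := avg_ancestor_small DP' e80.
pose N := maxn N1 N2.
have aN : a N ^+ 2 <= eps / 8 by apply: hN1; rewrite leq_maxl.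
have bN : b N ^+ 2 <= eps / 8 by apply: hN2; rewrite leq_maxr.
have rest : 2 * (a N - b N) ^+ 2 <= eps.
  by have := sqr_ge0 (a N + b N); nra.
have := telescope_sqr_le N t_gt1 step.
rewrite -lee_fin => /le_trans; apply.
rewrite addrC EFinD; apply: leeD; last by rewrite lee_fin.
rewrite -sumEFin.
under eq_bigr do rewrite EFinD eE e'E.
rewrite big_split /=.
have part (u : nat -> \bar R) : (forall j, (0 <= u j)%E) ->
    (\sum_(j < N) u j <= \esum_(j in [set: nat]) u j)%E.
  move=> u0; rewrite -nneseries_esumT// -(big_mkord xpredT u).
  by apply: nneseries_lim_ge.
by apply: leeD; apply: part => j; exact: tail_term_ge0.
Qed.

Definition osc P (x : borelRn R n) : \bar R :=
  (((f x - avg P) ^+ 2)%:E + tail P x)%E.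

Lemma osc_ge0 P x : (0 <= osc P x)%E.
Proof. by rewrite adde_ge0 ?tail_ge0// lee_fin sqr_ge0. Qed.

Lemma measurable_osc P : measurable_fun setT (osc P).
Proof.
apply: emeasurable_funD; first exact: measurable_sqrB f2 _ _.
exact: measurable_tail.
Qed.

Lemma sqrB_le_osc P P' x y : D P -> D P' -> side P = side P' ->
  cube_set P x -> cube_set P' y ->
  (forall i, `|x ord0 i - y ord0 i| <= side P) ->
  (((f x - f y) ^+ 2)%:E <= 3%:E * osc P x + 3%:E * osc P' y)%E.
Proof.
move=> DP DP' PP' Px P'y xy.
have tails := avg_diff_le DP DP' PP' Px P'y xy.
apply: (@le_trans _ _ (3%:E * (((f x - avg P) ^+ 2)%:E + ((f y - avg P') ^+ 2)%:E
    + ((avg P - avg P') ^+ 2)%:E))%E).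
  rewrite -!EFinD -EFinM lee_fin.
  have -> : f x - f y = (f x - avg P) - (f y - avg P') + (avg P - avg P') by ring.
  move: (f x - avg P) (f y - avg P') (avg P - avg P') => u v w.
  have := sqr_ge0 (u + v); have := sqr_ge0 (u - w); have := sqr_ge0 (v + w).
  by nra.
rewrite -muleDr//; last by rewrite ge0_adde_def// inE; exact: osc_ge0.
apply: lee_wpmul2l; first by rewrite lee_fin.
rewrite /osc addeACA; exact: leeD.
Qed.

(** Four times [P]: it contains every point within one side length of [P]. *)
Definition quad P : cube R n := Defs.double (Defs.double P).

Lemma mem_quad P x y : cube_set P x ->
  (forall i, `|x ord0 i - y ord0 i| <= side P) -> cube_set (quad P) y.
Proof.
move=> Px xy i; have /andP[a b] := Px i; have := xy i.
rewrite /quad /Defs.double /corner /side !mxE /= -/(corner P) -/(side P) ler_norml.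
by move=> /andP[c d]; apply/andP; split; lra.
Qed.

Lemma mu_quad_le P : 0 < side P -> (mu (cube_set (quad P)) <= (C ^+ 2 * mass P)%:E)%E.
Proof.
move=> P0; apply: le_trans (muC _) _.
  have -> : side (Defs.double P) = 2 * side P by [].
  by rewrite mulr_gt0.
rewrite expr2 -mulrA EFinM lee_wpmul2l ?lee_fin ?(ltW C_gt0)//.
by rewrite EFinM -muE muC.
Qed.

Definition spread P (y : borelRn R n) : \bar R :=
  (weight P / mass P * \1_(cube_set (quad P)) y)%:E.

Definition osc_on P (x : borelRn R n) : \bar R :=
  (osc P x * (\1_(cube_set P) x)%:E)%E.

Lemma spread_ge0 P y : (0 <= spread P y)%E.
Proof. by rewrite lee_fin mulr_ge0// divr_ge0 ?weight_ge0 ?mass_ge0. Qed.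

Lemma osc_on_ge0 P y : (0 <= osc_on P y)%E.
Proof. by rewrite mule_ge0 ?osc_ge0// lee_fin. Qed.

Lemma measurable_spread P : measurable_fun setT (spread P).
Proof.
apply/measurable_EFinP; apply: measurable_funM => //.
by apply: measurable_indic; exact: measurable_cube_set.
Qed.

Lemma measurable_osc_on P : measurable_fun setT (osc_on P).
Proof.
apply: emeasurable_funM; first exact: measurable_osc.
by apply/measurable_EFinP; apply: measurable_indic; exact: measurable_cube_set.
Qed.

(** A sum of products of a function of [x] by a function of [y], so that the
double integral is computed term by term. *)
Definition majorant (x y : borelRn R n) : \bar R :=
  \esum_(P in D) (spread P y * osc_on P x)%E.

Lemma majorant_ge0 x y : (0 <= majorant x y)%E.
Proof. by apply: esum_ge0 => P _; rewrite mule_ge0 ?spread_ge0 ?osc_on_ge0. Qed.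

Lemma osc_le_majorant P x y : D P -> cube_set P x ->
  (forall i, `|x ord0 i - y ord0 i| <= side P) ->
  ((weight P / mass P)%:E * osc P x <= majorant x y)%E.
Proof.
move=> DP Px xy.
apply: (@le_trans _ _ (\esum_(Q in [set P]) (spread Q y * osc_on Q x)%E)); last first.
  by apply: le_esum_subset => _ ->.
rewrite esum_set1; last by rewrite mule_ge0 ?spread_ge0 ?osc_on_ge0.
rewrite /spread /osc_on !indicE (mem_set Px) (mem_set (mem_quad Px xy)).
by rewrite mulr1 mule1.
Qed.

Let majorant_const : R := 3 * q^-1 * C ^+ (n + 3).
Let majorant_const_ge0 : 0 <= majorant_const.
Proof.
by rewrite mulr_ge0 ?exprn_ge0 ?(ltW C_gt0)// mulr_ge0 ?invr_ge0 ?(ltW q_gt0).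
Qed.

(** The part of the estimate that involves [osc P x] is normalized by the mass of
the cube of [x], the other one by the mass of the cube of [y]; both
normalizations are allowed since the ball is symmetric in [x] and [y]. *)
Lemma integrand_le_majorant x y :
  (sobolev_integrand mu s f x y <= majorant_const%:E * (majorant x y + majorant y x))%E.
Proof.
have [->|xy] := eqVneq x y.
  rewrite /sobolev_integrand subrr mul0r expr0n mul0e.
  by rewrite mule_ge0 ?lee_fin// adde_ge0 ?majorant_ge0.
have [b b0 mB] := mu_midball_bounds n_gt0 C_ge1 muC mu_lf muT xy.
rewrite (sobolev_integrandE s f xy b0 mB).
have d0 : 0 < enorm (x - y) by apply: enorm_gt0; rewrite subr_eq0.
set d := enorm (x - y) in d0 *.
have [k [dk kd]] := dyadic_scale d0.
have [P [DP sP Px]] := grid_cell gD k x.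
have [P' [DP' sP' P'y]] := grid_cell gD k y.
have P0 := grid_side_gt0 gD DP.
have PP' : side P = side P' by rewrite sP.
have near_xy i : `|x ord0 i - y ord0 i| <= side P.
  have := coord_le_enorm (x - y) i; rewrite !mxE -/d => /le_trans; apply.
  by rewrite sP.
have near_yx i : `|y ord0 i - x ord0 i| <= side P' by rewrite distrC -PP'.
pose W := d `^ (- (2 * s)).
have W0 : 0 <= W by exact: powR_ge0.
have Wle : W <= q^-1 * weight P.
  rewrite /W -[weight P]/(side P `^ (- (2 * s))).
  have -> : side P = 2 * (side P / 2) by field.
  rewrite powRM ?divr_ge0 ?(ltW P0)// mulrA mulVf ?gt_eqF// mul1r.
  rewrite !powRN lef_pV2 ?posrE ?powR_gt0 ?divr_gt0//.
  rewrite ge0_ler_powR ?nnegrE ?mulr_ge0 ?divr_ge0 ?(ltW s_gt0) ?(ltW P0) ?(ltW d0)//.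
  by rewrite ler_pdivrMr// mulrC sP ltW.
have coef Q z w : D Q -> side Q = side P -> cube_set Q z ->
    mu (midball z w) = b%:E -> enorm (z - w) = d ->
    W / b * 3 <= majorant_const * (weight Q / mass Q).
  move=> DQ sQ Qz mzw dzw; have m0 := mass0 DQ.
  have := mu_midball_ge n_gt0 C_ge1 muC _ _ Qz.
  move=> /(_ w); rewrite dzw sQ sP muE mzw -EFinM lee_fin => /(_ dk kd) mb.
  have -> : weight Q = weight P by rewrite -[weight Q]/(side Q `^ _) sQ.
  have -> : majorant_const * (weight P / mass Q) =
    3 * ((q^-1 * weight P) * (C ^+ (n + 3) / mass Q)) by rewrite /majorant_const; ring.
  rewrite mulrC ler_pM2l//; apply: ler_pM => //.
    by rewrite invr_ge0 ltW.
  by rewrite ler_pdivlMr// mulrC ler_pdivrMr.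
have cP := coef P x y DP erefl Px mB erefl.
have cP' := coef P' y x DP' (esym PP') P'y.
rewrite midballC mB enormB in cP'; have {}cP' := cP' erefl erefl.
have Wb : 0 <= W / b by rewrite divr_ge0 ?(ltW b0).
have -> : W * (f x - f y) ^+ 2 / b = W / b * (f x - f y) ^+ 2 by ring.
rewrite EFinM.
apply: le_trans (lee_wpmul2l _ (sqrB_le_osc DP DP' PP' Px P'y near_xy)) _.
  by rewrite lee_fin.
have half Q z w : D Q -> cube_set Q z -> (forall i, `|z ord0 i - w ord0 i| <= side Q) ->
   W / b * 3 <= majorant_const * (weight Q / mass Q) ->
   ((W / b)%:E * (3%:E * osc Q z) <= majorant_const%:E * majorant z w)%E.
  move=> DQ Qz zw cQ; rewrite muleA -EFinM.
  apply: (@le_trans _ _ (majorant_const%:E * ((weight Q / mass Q)%:E * osc Q z))%E).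
    by rewrite muleA -EFinM lee_wpmul2r ?osc_ge0// lee_fin.
  by rewrite lee_wpmul2l// ?lee_fin// osc_le_majorant.
rewrite [leLHS]ge0_muleDr ?mule_ge0 ?osc_ge0 ?lee_fin//.
rewrite [leRHS]ge0_muleDr ?majorant_ge0//.
by apply: leeD; [exact: half|exact: half].
Qed.

Let cD : countable D. Proof. exact: grid_countable gD. Qed.

Lemma integral_spread_le P : D P -> (\int[mu]_y spread P y <= (C ^+ 2 * weight P)%:E)%E.
Proof.
move=> DP; rewrite /spread; under eq_integral do rewrite EFinM.
have c0 : 0 <= weight P / mass P by rewrite divr_ge0 ?weight_ge0 ?mass_ge0.
rewrite ge0_integralZl//; last first.
  by apply/measurable_EFinP; apply: measurable_indic; exact: measurable_cube_set.
rewrite integral_indic ?setIT//; last exact: measurable_cube_set.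
apply: le_trans (lee_wpmul2l _ (mu_quad_le (grid_side_gt0 gD DP))) _.
  by rewrite lee_fin.
rewrite -EFinM lee_fin le_eqVlt; apply/orP; left; apply/eqP.
by field; rewrite gt_eqF ?mass0.
Qed.

Lemma integral_osc_on P :
  (\int[mu]_x osc_on P x = \int[mu]_(x in cube_set P) osc P x)%E.
Proof. exact: integral_mul_indic. Qed.

Lemma esum_spread_osc_on_le :
  (\esum_(P in D) (\int[mu]_y spread P y * \int[mu]_x osc_on P x) <=
   (C ^+ 2)%:E * \esum_(P in D) ((weight P)%:E * \int[mu]_(x in cube_set P) osc P x))%E.
Proof.
have osc0 P : (0 <= \int[mu]_(x in cube_set P) osc P x)%E.
  by apply: integral_ge0 => x _; exact: osc_ge0.
rewrite -esumZl ?exprn_ge0 ?(ltW C_gt0)//; last first.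
  by move=> P _; rewrite mule_ge0// lee_fin weight_ge0.
apply: le_esum => P DP; rewrite integral_osc_on muleA -EFinM.
by rewrite lee_wpmul2r// integral_spread_le.
Qed.

Lemma sobolev_le_osc :
  (sobolev_sqnorm mu s f <= (2 * (majorant_const * C ^+ 2))%:E *
    \esum_(P in D) ((weight P)%:E * \int[mu]_(x in cube_set P) osc P x))%E.
Proof.
set V := \esum_(P in D) _.
have mn := measurable_osc_on; have mfa := measurable_spread.
have n0 := osc_on_ge0; have fa0 := spread_ge0.
have mmaj1 y : measurable_fun setT (majorant ^~ y).
  apply: measurable_esum => // [P _|P x _]; first exact: measurable_funeM.
  by rewrite mule_ge0.
have mmaj2 y : measurable_fun setT (majorant y).
  apply: measurable_esum => // [P _|P x _]; last by rewrite mule_ge0.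
  by apply: emeasurable_funM => //; exact: measurable_cst.
have flip x y : majorant y x = (\esum_(P in D) (osc_on P y * spread P x))%E.
  by apply: eq_esum => P _; rewrite muleC.
have inner y : (\int[mu]_x (majorant_const%:E * (majorant x y + majorant y x)) =
    majorant_const%:E * (\int[mu]_x majorant x y + \int[mu]_x majorant y x))%E.
  rewrite ge0_integralZl ?lee_fin//.
  - by rewrite ge0_integralD// => x _; exact: majorant_ge0.
  - exact: (emeasurable_funD (mmaj1 y) (mmaj2 y)).
  - by move=> x _; rewrite adde_ge0 ?majorant_ge0.
have m1 : measurable_fun setT (fun y : borelRn R n => \int[mu]_x majorant x y)%E.
  exact: measurable_esum_prod1.
have m2 : measurable_fun setT (fun y : borelRn R n => \int[mu]_x majorant y x)%E.
  under eq_fun do under eq_integral do rewrite flip.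
  exact: measurable_esum_prod1.
have i1 y : (0 <= \int[mu]_x majorant x y)%E.
  by apply: integral_ge0 => x _; exact: majorant_ge0.
have i2 y : (0 <= \int[mu]_x majorant y x)%E.
  by apply: integral_ge0 => x _; exact: majorant_ge0.
apply: (@le_trans _ _ (\int[mu]_y \int[mu]_x
    (majorant_const%:E * (majorant x y + majorant y x)))%E).
  have I0 x y := sobolev_integrand_ge0 mu s f x y.
  apply: ge0_integral_mono => y _; first by apply: integral_ge0 => x _.
  by apply: ge0_integral_mono => x _ //; exact: integrand_le_majorant.
under eq_integral do rewrite inner.
rewrite ge0_integralZl ?lee_fin//; last 2 first.
- exact: (emeasurable_funD m1 m2).
- by move=> y _; rewrite adde_ge0.
rewrite (ge0_integralD _ measurableT (fun (y : borelRn R n) _ => i1 y) m1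
  (fun (y : borelRn R n) _ => i2 y) m2).
have -> : (\int[mu]_y \int[mu]_x majorant x y =
    \esum_(P in D) (\int[mu]_y spread P y * \int[mu]_x osc_on P x))%E.
  exact: (integral_esum_prod mu cD mfa mn fa0 n0).
have -> : (\int[mu]_y \int[mu]_x majorant y x =
    \esum_(P in D) (\int[mu]_y spread P y * \int[mu]_x osc_on P x))%E.
  under eq_integral do under eq_integral do rewrite flip.
  rewrite (integral_esum_prod mu cD mn mfa n0 fa0).
  by apply: eq_esum => P _; rewrite muleC.
have V0 : (0 <= V)%E.
  apply: esum_ge0 => P _; rewrite mule_ge0 ?lee_fin ?weight_ge0//.
  by apply: integral_ge0 => x _; exact: osc_ge0.
have c0 : 0 <= majorant_const * C ^+ 2.
  by rewrite mulr_ge0// exprn_ge0// ltW.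
apply: le_trans (lee_wpmul2l _ (leeD esum_spread_osc_on_le esum_spread_osc_on_le)) _.
  by rewrite lee_fin.
rewrite -/V -ge0_muleDl ?lee_fin ?exprn_ge0 ?(ltW C_gt0)//.
rewrite muleA -EFinD -EFinM lee_wpmul2r// lee_fin.
by rewrite le_eqVlt; apply/orP; left; apply/eqP; ring.
Qed.

Let rho : R := decay C.
Let rho_gt0 : 0 < rho.
Proof. by have [a b] := decay_bounds C_ge1; rewrite /rho; lra. Qed.

Hypothesis ratio_lt1 : q^-1 * t * rho < 1.

Let ratio_ge0 : 0 <= q^-1 * t * rho.
Proof. by rewrite mulr_ge0 ?(ltW rho_gt0)// mulr_ge0// invr_ge0 ltW. Qed.

Definition halo_term P j : \bar R :=
  ((weight P * (K * t ^+ j * jump (ancestor D j P)))%:E *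
   mu (halo (ancestor D j P) (side P) `&` cube_set P))%E.

Lemma halo_term_ge0 P j : (0 <= halo_term P j)%E.
Proof.
rewrite mule_ge0// lee_fin mulr_ge0 ?weight_ge0//.
by rewrite mulr_ge0 ?jump_ge0// mulr_ge0// exprn_ge0.
Qed.

Lemma weight_integral_osc P :
  ((weight P)%:E * \int[mu]_(x in cube_set P) osc P x =
   (weight P)%:E * energy P + \esum_(j in [set: nat]) halo_term P j)%E.
Proof.
have mP := measurable_cube_set P.
have t0 := tail_ge0 P.
rewrite /osc ge0_integralD//; last 3 first.
- by move=> x _; rewrite lee_fin sqr_ge0.
- exact: measurable_sqrB f2 _ _.
- exact: measurable_funS (measurable_tail P).
have e0 : (0 <= energy P)%E.
  by apply: integral_ge0 => x _; rewrite lee_fin sqr_ge0.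
rewrite ge0_muleDr//; last by apply: integral_ge0.
congr (_ + _)%E; rewrite /tail integral_esum//; last 3 first.
- exact: countableP.
- move=> j _; exact: measurable_funS (measurable_tail_term P j).
- by move=> j x _; exact: tail_term_ge0.
rewrite -esumZl ?weight_ge0//; last first.
  by move=> j _; apply: integral_ge0 => x _; exact: tail_term_ge0.
apply: eq_esum => j _; rewrite /tail_term ge0_integralZl//; last 2 first.
- apply/measurable_EFinP; apply: measurable_indic; exact: measurable_halo.
- rewrite lee_fin; have := jump_ge0 (ancestor D j P); move: (jump _) => a a0.
  by rewrite mulr_ge0// mulr_ge0// exprn_ge0.
rewrite integral_indic//; last exact: measurable_halo.
by rewrite muleA -EFinM.
Qed.

Let halo_const : R := K * rho ^- 2 / (1 - q^-1 * t * rho).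

(** Summed over the cubes [P] whose ancestor of order [j] is [Q], the measures
of the layers inside [P] add up to at most the measure of the layer of [Q] of
width [side Q / 2 ^ j]. *)
Lemma halo_sum_le : (\esum_(P in D) \esum_(j in [set: nat]) halo_term P j <=
  \esum_(Q in D) (halo_const * (weight Q * jump Q * mass Q))%:E)%E.
Proof.
have regroup : (\esum_(P in D) \esum_(j in [set: nat]) halo_term P j =
    \esum_(Q in D) \esum_(j in [set: nat])
      \esum_(P in D `&` ancestor D j @^-1` [set Q]) halo_term P j)%E.
  rewrite exchange_esum; last by move=> P j _ _; exact: halo_term_ge0.
  rewrite [RHS]exchange_esum; last first.
    by move=> Q j _ _; apply: esum_ge0 => P _; exact: halo_term_ge0.
  apply: eq_esum => j _; apply: esum_fiber.
    by move=> P DP; have [] := ancestorP n_gt0 gD j DP.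
  by move=> P _; exact: halo_term_ge0.
rewrite regroup; apply: le_esum => Q DQ.
have z0 : 0 <= weight Q * jump Q * mass Q.
  by rewrite mulr_ge0 ?mass_ge0// mulr_ge0 ?weight_ge0 ?jump_ge0.
pose c := K * rho ^- 2 * (weight Q * jump Q * mass Q).
have c0 : 0 <= c by rewrite mulr_ge0// mulr_ge0// invr_ge0 exprn_ge0// ltW.
apply: (@le_trans _ _ (\esum_(j in [set: nat]) (c * (q^-1 * t * rho) ^+ j)%:E)%E);
  last first.
  apply: le_trans (esum_geometric_le c0 ratio_ge0 ratio_lt1) _.
  by rewrite lee_fin le_eqVlt; apply/orP; left; apply/eqP; rewrite /c /halo_const; ring.
apply: le_esum => j _; set h := side Q / 2 ^+ j.
have mh := measurable_halo Q h.
have fiberE P : (D `&` ancestor D j @^-1` [set Q]) P ->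
    halo_term P j = ((weight Q * q^-1 ^+ j * (K * t ^+ j * jump Q))%:E *
      mu (halo Q h `&` cube_set P))%E.
  move=> [DP AP]; have [_ sA _] := ancestorP n_gt0 gD j DP.
  rewrite /halo_term AP in sA *.
  have -> : side P = h.
    by rewrite /h sA mulrC mulKf// gt_eqF// exprn_gt0.
  rewrite (weight_scale s (ltW (grid_side_gt0 gD DP)) sA) -/q exprVn mulfK//.
  by rewrite gt_eqF// exprn_gt0.
rewrite (eq_esum fiberE) esumZl//; last first.
  rewrite mulr_ge0//; last by rewrite mulr_ge0 ?jump_ge0// mulr_ge0// exprn_ge0.
  by rewrite mulr_ge0 ?weight_ge0// exprn_ge0// invr_ge0 ltW.
set k := _ * _ * _.
have k0 : 0 <= k.
  rewrite /k mulr_ge0//; last by rewrite mulr_ge0 ?jump_ge0// mulr_ge0// exprn_ge0.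
  by rewrite mulr_ge0 ?weight_ge0// exprn_ge0// invr_ge0 ltW.
apply: (@le_trans _ _ (k%:E * mu (halo Q h))%E).
  apply: lee_wpmul2l; first by rewrite lee_fin.
  apply: esum_measure_le => //.
  - by move=> P _; apply: measurableI => //; exact: measurable_cube_set.
  - move=> P P' [DP AP] [DP' AP'] [x [[_ Px] [_ P'x]]].
    apply: (grid_level_inj gD DP DP' _ Px P'x).
    have [_ sA _] := ancestorP n_gt0 gD j DP.
    have [_ sA' _] := ancestorP n_gt0 gD j DP'.
    have p2 : (2 : R) ^+ j != 0 by rewrite gt_eqF// exprn_gt0.
    by apply: (mulfI p2); rewrite -sA -sA' AP AP'.
apply: le_trans (lee_wpmul2l _ (halo_decay C_ge1 muC mu_lf n_gt0 gD j DQ)) _.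
  by rewrite lee_fin.
rewrite muE -!EFinM lee_fin le_eqVlt; apply/orP; left; apply/eqP.
by rewrite /k /c -/rho !exprMn; ring.
Qed.

(** By Jensen's inequality the squared jump at [Q], times the mass of [Q], is at
most the oscillation on [Q] of [f] around the average over the parent; the
children of a cube being disjoint, these add up to the energy of the parent. *)
Lemma jump_sum_le : (\esum_(Q in D) (weight Q * jump Q * mass Q)%:E <=
  (q^-1)%:E * dyadic_sobolev_sqnorm mu D s f)%E.
Proof.
have q0 : 0 <= q^-1 by rewrite invr_ge0 ltW.
have sq0 c x : (0 <= ((f x - c) ^+ 2)%:E)%E by rewrite lee_fin sqr_ge0.
have e0 P : (0 <= energy P)%E by exact: integral_ge0.
rewrite (dyadic_sqnormE gD s f2) -esumZl//; last first.
  by move=> P _; rewrite mule_ge0// lee_fin weight_ge0.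
rewrite (esum_fiber (B := D) (h := parent D)); last 2 first.
- by move=> Q DQ; have [] := parentP n_gt0 gD DQ.
- by move=> Q DQ; rewrite lee_fin mulr_ge0 ?mass_ge0// mulr_ge0 ?weight_ge0 ?jump_ge0.
apply: le_esum => P DP.
apply: (@le_trans _ _ (\esum_(Q in D `&` parent D @^-1` [set P])
    ((q^-1 * weight P)%:E * \int[mu]_(x in cube_set Q) ((f x - avg P) ^+ 2)%:E))%E).
  apply: le_esum => Q [DQ QP].
  have [_ sP _] := parentP n_gt0 gD DQ.
  rewrite -[2]/(2 ^+ 1) QP in sP.
  rewrite (weight_scale s (ltW (grid_side_gt0 gD DQ)) sP) -/q expr1.
  rewrite [q^-1 * _]mulrC mulfK ?gt_eqF// -mulrA EFinM.
  apply: lee_wpmul2l; first by rewrite lee_fin weight_ge0.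
  rewrite /jump QP mulrC.
  exact: (jensen_sqr f2 (measurable_cube_set Q) (mu_cube_fin C_ge1 muC mu_lf Q)).
rewrite esumZl//; last 2 first.
- by rewrite mulr_ge0 ?weight_ge0.
- by move=> Q _; exact: integral_ge0.
rewrite muleA -EFinM; apply: lee_wpmul2l; first by rewrite lee_fin mulr_ge0 ?weight_ge0.
apply: esum_integral_le => //.
- by apply: sub_countable cD; apply: subset_card_le => Q [].
- exact: measurable_cube_set.
- by move=> Q _; exact: measurable_cube_set.
- by move=> Q [DQ QP]; have [_ _] := parentP n_gt0 gD DQ; rewrite QP.
- move=> Q Q' [DQ QP] [DQ' QP'] [x [Qx Q'x]].
  apply: (grid_level_inj gD DQ DQ' _ Qx Q'x).
  have [_ sP _] := parentP n_gt0 gD DQ; have [_ sP' _] := parentP n_gt0 gD DQ'.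
  have two0 : (2 : R) != 0 by [].
  by apply: (mulfI two0); rewrite -sP -sP' QP QP'.
- exact: measurable_sqrB f2 _ _.
Qed.

Definition upper_const : R :=
  2 * (majorant_const * C ^+ 2) * (1 + halo_const * q^-1).

Lemma halo_const_ge0 : 0 <= halo_const.
Proof.
rewrite divr_ge0 ?subr_ge0 ?(ltW ratio_lt1)// mulr_ge0// invr_ge0.
by rewrite exprn_ge0// ltW.
Qed.

Lemma sobolev_le_dyadic :
  (sobolev_sqnorm mu s f <= upper_const%:E * dyadic_sobolev_sqnorm mu D s f)%E.
Proof.
apply: le_trans sobolev_le_osc _.
have k0 : 0 <= 2 * (majorant_const * C ^+ 2).
  by rewrite mulr_ge0// mulr_ge0// exprn_ge0// ltW.
rewrite /upper_const [in leRHS]EFinM -muleA.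
apply: lee_wpmul2l; first by rewrite lee_fin.
have sq0 c x : (0 <= ((f x - c) ^+ 2)%:E)%E by rewrite lee_fin sqr_ge0.
have e0 P : (0 <= energy P)%E by exact: integral_ge0.
have we0 P : (0 <= (weight P)%:E * energy P)%E by rewrite mule_ge0// lee_fin weight_ge0.
under eq_esum do rewrite weight_integral_osc.
rewrite esumD//; last by move=> P _; apply: esum_ge0 => j _; exact: halo_term_ge0.
rewrite -(dyadic_sqnormE gD s f2).
have dy0 : (0 <= dyadic_sobolev_sqnorm mu D s f)%E.
  by rewrite (dyadic_sqnormE gD s f2); exact: esum_ge0.
have cc0 := halo_const_ge0.
have q0 : 0 <= q^-1 by rewrite invr_ge0 ltW.
rewrite EFinD ge0_muleDl ?lee_fin//; last exact: mulr_ge0.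
apply: leeD; first by rewrite mul1e.
apply: le_trans halo_sum_le _.
under eq_esum do rewrite EFinM.
rewrite esumZl//; last first.
  by move=> Q DQ; rewrite lee_fin mulr_ge0 ?mass_ge0// mulr_ge0 ?weight_ge0 ?jump_ge0.
rewrite [in leRHS]EFinM -muleA; apply: lee_wpmul2l; first by rewrite lee_fin.
exact: jump_sum_le.
Qed.

End Upper.

(** * The equivalence of the two norms *)

(** The zero measure is doubling. It is treated apart because averages and
balls then have no mass. *)
Lemma integral_null_measure d (T : measurableType d) (R : realType)
    (mu : {measure set T -> \bar R}) (A : set T) (g : T -> \bar R) :
  measurable A -> mu setT = 0%E -> (forall x, 0 <= g x)%E ->
  (\int[mu]_(x in A) g x = 0)%E.
Proof.
move=> mA mu0 g0; have muA : mu A = 0%E.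
  by apply/eqP; rewrite eq_le measure_ge0 andbT -mu0 le_measure// inE.
apply/eqP; rewrite eq_le integral_ge0 ?andbT//.
rewrite -(null_set_integral mA (measurable_cst (+oo%E : \bar R)) muA).
by apply: ge0_integral_mono => x _ //; exact: leey.
Qed.

Theorem theorem18 (R : realType) (n : nat) (n_gt0 : (0 < n)%N)
    (mu : {measure set (borelRn R n) -> \bar R})
    (mu_lf : locally_finite_measure mu) (mu_doubling : doubling mu) :
  exists2 s0 : R, 0 < s0 &
    forall (D : set (cube R n)), dyadic_grid D ->
    forall s : R, 0 < s -> s < s0 ->
    exists2 c : R, 0 < c &
      forall f : borelRn R n -> R, f \in Lfun mu 2%:E ->
        (c^-1%:E * dyadic_sobolev_sqnorm mu D s f <= sobolev_sqnorm mu s f)%E /\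
        (sobolev_sqnorm mu s f <= c%:E * dyadic_sobolev_sqnorm mu D s f)%E.
Proof.
have [muT0|muT] := eqVneq (mu setT) 0%E.
  exists 1 => // D gD s s0 s1; exists 1 => // f f2.
  have -> : dyadic_sobolev_sqnorm mu D s f = 0%E.
    apply: esum1 => Q DQ; apply: integral_null_measure => //.
    exact: measurable_cube_set.
  have -> : sobolev_sqnorm mu s f = 0%E.
    apply: integral_null_measure => // y; apply: integral_ge0 => x _.
    exact: sobolev_integrand_ge0.
  by rewrite !mule0.
have [C C1 muC] := doubling_ge1 mu_doubling.
have C0 : 0 < C by exact: lt_le_trans C1.
have [d1 d2] := decay_bounds C1.
(* With x = 1 - decay C, the product of the growth t = 1 + x / 2 lost in the
   Cauchy-Schwarz inequality, of 4 ^ s <= t and of the decay 1 - x is below 1 *)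
pose t := 1 + (1 - decay C) / 2.
have t1 : 1 < t by rewrite /t; lra.
have t0 : 0 < t by lra.
have d0 : 0 < decay C by lra.
have ln2 : 0 < ln 2 :> R by rewrite ln_gt0// ltr1n.
exists (ln t / (2 * ln 2)).
  by rewrite divr_gt0// ?mulr_gt0// ln_gt0.
move=> D gD s s0 s_lt.
have q_le : (2 `^ (- (2 * s)))^-1 <= t.
  rewrite powRN invrK /powR gt_eqF// -[leRHS]lnK// ler_expR ltW//.
  by move: s_lt; rewrite ltr_pdivlMr ?mulr_gt0// [s * _]mulrA [s * 2]mulrC.
have ratio : (2 `^ (- (2 * s)))^-1 * t * decay C < 1.
  apply: le_lt_trans (_ : t * t * decay C < 1).
    by rewrite ler_wpM2r ?(ltW d0)// ler_wpM2r// ltW.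
  rewrite /t; move: d1 d2; move: (decay C) => r d1 d2.
  by have : 0 < (1 - r) ^+ 2 by [rewrite exprn_gt0// subr_gt0]; nra.
pose K1 := C ^+ n.+1 * kernel_const n s.
have K1_gt0 : 0 < K1 by rewrite mulr_gt0 ?exprn_gt0 ?kernel_const_gt0.
pose K2 := upper_const n C s t.
exists (Num.max K1 K2) => [|f f2]; first by rewrite lt_max K1_gt0.
have dy0 : (0 <= dyadic_sobolev_sqnorm mu D s f)%E.
  apply: esum_ge0 => Q _; apply: integral_ge0 => x _.
  by rewrite lee_fin sqr_ge0.
split.
  apply: le_trans (dyadic_le_sobolev n_gt0 C1 muC mu_lf muT gD s0 f2).
  apply: lee_wpmul2r => //; rewrite lee_fin lef_pV2 ?posrE//.
    by rewrite le_max lexx.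
  by rewrite lt_max K1_gt0.
apply: le_trans (sobolev_le_dyadic n_gt0 C1 muC mu_lf muT gD s0 f2 t1 ratio) _.
by apply: lee_wpmul2r => //; rewrite lee_fin le_max lexx orbT.
Qed.
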